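(* Let $f$ be an extended Rademacher random multiplicative function, let $g(n)=\mu^2(n)f(n)$ where $\mu$ is the Möbius function (so $g$ is the Rademacher random multiplicative function supported on squarefree integers), and let $h\in\{f,g\}$. Then, almost surely, for all sufficiently large $x$, $$N_h(x)\gg\log\log x .$$
   Context: An extended Rademacher random multiplicative function $f\colon\mathbb N\to\{-1,1\}$ is obtained by taking $(f(p))_{p\text{ prime}}$ to be independent Rademacher random variables (each $\pm1$ with probability $1/2$) and extending $f$ completely multiplicatively to $\mathbb N$. For $h\in\{f,g\}$, $N_h(x)$ denotes the number of sign changes of the partial sums $\sum_{n\le y}h(n)$ for $y\in[1,x]$, i.e. the number of sign changes in the finite sequence of partial sums $\sum_{n\le m}h(n)$, $m=1,\dots,\lfloor x\rfloor$, after zero values are discarded. The implied constant in $\gg$ is absolute (while the threshold ''sufficiently large'' may depend on the realisation). *)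

(* Defs.v *)
From HB Require Import structures.
From mathcomp Require Export all_boot all_order all_algebra finmap.
From mathcomp Require Export all_classical all_reals all_analysis.
From mathcomp Require qe_rcf_th.

Set Implicit Arguments.
Unset Strict Implicit.
Unset Printing Implicit Defensive.

Import Order.TTheory GRing.Theory Num.Theory.
Import numFieldNormedType.Exports.

Local Open Scope classical_set_scope.
Local Open Scope ring_scope.

Definition mutually_independent d (T : measurableType d) (R : realType)
    (P : probability T R) (I : choiceType) (D : set I)
    (X : I -> {RV P >-> R}) : Prop :=
  forall (J : {fset I}) (B : I -> set R),
    [set` J] `<=` D -> (forall i, measurable (B i)) ->
    P (\bigcap_(i in [set` J]) (X i @^-1` B i)) =
      (\prod_(i <- J) P (X i @^-1` B i))%E.

Definition rademacher d (T : measurableType d) (R : realType)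
    (P : probability T R) (X : {RV P >-> R}) : Prop :=
  P (X @^-1` [set 1]) = (2^-1)%:E /\ P (X @^-1` [set -1]) = (2^-1)%:E.

(* Arithmetic functions live on the positive integers: the value at 0 is
   unconstrained and is never used. *)
Definition completely_multiplicative (R : realType) (a : nat -> R) : Prop :=
  a 1%N = 1 /\
  forall m n, (0 < m)%N -> (0 < n)%N -> a (m * n)%N = a m * a n.

Record extended_rademacher d (T : measurableType d) (R : realType)
    (P : probability T R) (f : nat -> {RV P >-> R}) : Prop := {
  ext_rademacher_sign :
    forall n w, (0 < n)%N -> f n w = 1 \/ f n w = -1 ;
  ext_rademacher_law : forall p, prime p -> rademacher (f p) ;
  ext_rademacher_indep : mutually_independent [set p | prime p] f ;
  ext_rademacher_mult :
    forall w, completely_multiplicative (fun n => f n w) }.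

Definition squarefree (n : nat) : bool :=
  (0 < n)%N && all (fun p => ~~ (p ^ 2 %| n)%N) (primes n).

Definition mobius (n : nat) : int :=
  if squarefree n then (-1) ^+ size (primes n) else 0.

Definition partial_sum (R : realType) (a : nat -> R) (m : nat) : R :=
  \sum_(1 <= n < m.+1) a n.

(* [qe_rcf_th.changes] counts the adjacent pairs with negative product. *)
Definition sign_changes (R : realType) (a : nat -> R) (x : R) : nat :=
  qe_rcf_th.changes
    [seq y <- [seq partial_sum a m | m <- iota 1 (Num.truncn x)] | y != 0].

(* Main.v *)
(* Write M(x) for the partial sums of h. Between the scales y = 2^e and
   y' = 2^(10 e), condition on the signs f(p), p <= y. For x <= y', the primes p
   of (2^(3e), 2^(8e)] with x / p <= y enter M(x) linearly:
   M(x) = Psi + S with S = sum_p f(p) M(x / p), where the M(x / p) are already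
   known and S is symmetric and independent of Psi. Let v(x) = sum_p M(x / p)^2
   be the variance of S and D(y) = sum_{x <= y} M(x)^2 / (x (x + 1)). Summing
   over x gives sum_x v(x) / (x (x + 1)) >= D(y) * sum_p 1 / p >= D(y) / 8.
   So if D(y') <= C D(y) with probability more than 3/4, some x has
   M(x)^2 = O(v(x)), hence Psi^2 = O(v(x)), with probability bounded below; as S
   exceeds any multiple of sqrt(v(x)) with positive probability in either
   direction, M(x) takes the sign opposite to the last nonzero partial sum up
   to y with probability bounded below.
   On the other hand E D(2^e) <= (1 + e)^2 makes D grow by at most a constant
   factor at most scales, so an exponential moment bound and the Borel-Cantelli
   lemma yield a positive proportion of scales e_k = 10^k e_0 with a sign
   change. *)

Require Import Defs.
From mathcomp Require Import ring lra zify.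

Set Implicit Arguments.
Unset Strict Implicit.
Unset Printing Implicit Defensive.

Import Order.TTheory GRing.Theory Num.Theory.
Import numFieldNormedType.Exports.

Local Open Scope classical_set_scope.
Local Open Scope ring_scope.

(** * Averages over independent signs *)

(* [eps p = true] encodes f(p) = -1; only prime indices matter. *)
Definition signs := nat -> bool.

Definition upd (eps : signs) (p : nat) (b : bool) : signs :=
  fun q => if q == p then b else eps q.

Definition agree_off (l : seq nat) (eps eps' : signs) : Prop :=
  forall q, q \notin l -> eps' q = eps q.

Lemma updC (eps : signs) p q b c : p != q ->
  upd (upd eps p b) q c = upd (upd eps q c) p b.
Proof.
move=> pq; apply/funext => r; rewrite /upd.
by case: eqP => // ->; rewrite eq_sym (negPf pq).
Qed.

Lemma updK (eps : signs) p b c : upd (upd eps p b) p c = upd eps p c.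
Proof. by apply/funext => r; rewrite /upd; case: eqP. Qed.

Section Averages.
Variable R : realType.
Implicit Types (Phi Psi : signs -> R) (eps : signs) (l : seq nat).

Definition avg1 p Phi eps : R :=
  (Phi (upd eps p false) + Phi (upd eps p true)) / 2.

(* Conditional expectation of [Phi] when the signs indexed by [l] are
   resampled and all the others are frozen to those of [eps]. *)
Definition avg l Phi : signs -> R := foldr avg1 Phi l.

Lemma avg_cat l1 l2 Phi : avg (l1 ++ l2) Phi = avg l1 (avg l2 Phi).
Proof. exact: foldr_cat. Qed.

Lemma agree_off_upd l p eps eps' b : agree_off l (upd eps p b) eps' ->
  agree_off (p :: l) eps eps'.
Proof.
move=> h q; rewrite inE negb_or => /andP[qp ql].
by rewrite h // /upd (negPf qp).
Qed.

Lemma avg_le l Phi Psi eps :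
  (forall eps', agree_off l eps eps' -> Phi eps' <= Psi eps') ->
  avg l Phi eps <= avg l Psi eps.
Proof.
elim: l eps => [|p l IH] eps h /=; first exact: h.
rewrite /avg1 ler_pM2r ?invr_gt0 ?ltr0n // lerD //.
  by apply: IH => e /agree_off_upd/h.
by apply: IH => e /agree_off_upd/h.
Qed.

Lemma eq_avg l Phi Psi eps :
  (forall eps', agree_off l eps eps' -> Phi eps' = Psi eps') ->
  avg l Phi eps = avg l Psi eps.
Proof.
by move=> h; apply/eqP; rewrite eq_le !avg_le // => e /h ->.
Qed.

Lemma avg_cst l c eps : avg l (fun=> c) eps = c.
Proof.
elim: l eps => [//|p l IH] eps; rewrite /= /avg1 !IH.
by lra.
Qed.

Lemma avgD l Phi Psi eps :
  avg l (fun e => Phi e + Psi e) eps = avg l Phi eps + avg l Psi eps.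
Proof.
elim: l eps => [//|p l IH] eps; rewrite /= /avg1 !IH -mulrDl.
by congr (_ / _); rewrite addrACA.
Qed.

Lemma avgZ l c Phi eps :
  avg l (fun e => c * Phi e) eps = c * avg l Phi eps.
Proof.
elim: l eps => [//|p l IH] eps; rewrite /= /avg1 !IH -mulrDr.
by rewrite mulrA.
Qed.

Lemma avg_sum (I : Type) (r : seq I) (Q : pred I) l (F : I -> signs -> R) eps :
  avg l (fun e => \sum_(i <- r | Q i) F i e) eps =
  \sum_(i <- r | Q i) avg l (F i) eps.
Proof.
elim: r => [|i r IH].
  by rewrite big_nil -[RHS](avg_cst l 0 eps); apply: eq_avg => *; rewrite big_nil.
rewrite big_cons -IH; case: (boolP (Q i)) => Qi.
  by rewrite -avgD; apply: eq_avg => *; rewrite big_cons Qi.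
by apply: eq_avg => *; rewrite big_cons (negPf Qi).
Qed.

Lemma avg_const l Phi c eps :
  (forall eps', agree_off l eps eps' -> Phi eps' = c) -> avg l Phi eps = c.
Proof. by move=> h; rewrite -[RHS](avg_cst l c eps); apply: eq_avg. Qed.

Lemma avg_ge0 l Phi eps :
  (forall eps', agree_off l eps eps' -> 0 <= Phi eps') -> 0 <= avg l Phi eps.
Proof. by move=> h; rewrite -(avg_cst l 0 eps); apply: avg_le. Qed.

Lemma avg1C p q Phi eps : avg1 p (avg1 q Phi) eps = avg1 q (avg1 p Phi) eps.
Proof.
have [->//|pq] := eqVneq p q.
rewrite /avg1 !(@updC _ p q) // -!mulrDl; congr (_ / _ / _).
by rewrite addrACA.
Qed.

Lemma avg1K p Phi eps : avg1 p (avg1 p Phi) eps = avg1 p Phi eps.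
Proof.
by rewrite /avg1 !updK; lra.
Qed.

Lemma eq_avg1 p Phi Psi eps : Phi =1 Psi -> avg1 p Phi eps = avg1 p Psi eps.
Proof. by move=> h; rewrite /avg1 !h. Qed.

Lemma avg_avg1C p l Phi eps : avg l (avg1 p Phi) eps = avg1 p (avg l Phi) eps.
Proof.
elim: l eps => [//|q l IH] eps /=.
by rewrite [RHS]avg1C; exact: eq_avg1.
Qed.

Lemma avg_avg1 p l Phi eps : p \in l -> avg l (avg1 p Phi) eps = avg l Phi eps.
Proof.
elim: l eps => [//|q l IH] eps; rewrite inE => /orP[/eqP <-|pl] /=.
  by rewrite -[RHS]avg1K; apply: eq_avg1 => e; exact: avg_avg1C.
by apply: eq_avg1 => e; exact: IH.
Qed.

(** Tower property of conditional expectation: averages over single signs commute and are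
    idempotent, so each one from [l'] is absorbed by its copy in [l]. *)
Lemma avg_tower l' l Phi eps : {subset l' <= l} ->
  avg l (avg l' Phi) eps = avg l Phi eps.
Proof.
elim: l' => [//|p l' IH] sub /=.
rewrite avg_avg1 ?sub ?mem_head // IH // => q ql.
by rewrite sub // inE ql orbT.
Qed.

(** A coupling: both averages are resampled with the same signs on [l]. *)
Lemma avg_dep l Phi eps eps' :
  (forall e e', agree_off l eps e -> agree_off l eps' e' -> {in l, e =1 e'} ->
    Phi e = Phi e') ->
  avg l Phi eps = avg l Phi eps'.
Proof.
elim: l eps eps' => [|p l IH] eps eps' h /=; first exact: h.
have E c : avg l Phi (upd eps p c) = avg l Phi (upd eps' p c).
  apply: IH => e e' he he' ee'; apply: h.
  - exact: agree_off_upd he.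
  - exact: agree_off_upd he'.
  move=> q; rewrite inE; have [ql _|ql] := boolP (q \in l); first exact: ee'.
  by rewrite orbF => /eqP qp; rewrite he // he' // /upd qp eqxx.
by rewrite /avg1 !E.
Qed.

End Averages.

(** * Tails of Rademacher sums *)

Section RademacherSums.
Variable R : realType.
Implicit Types (l : seq nat) (a : nat -> R) (eps : signs).

Definition rad_sum l a eps : R := \sum_(p <- l) (-1) ^+ eps p * a p.

(** By independence the moment generating function factors into hyperbolic cosines. *)
Lemma avg_expR_rad_sum l a t eps : uniq l ->
  avg l (fun e => expR (t * rad_sum l a e)) eps =
  \prod_(p <- l) ((expR (t * a p) + expR (- (t * a p))) / 2).
Proof.
elim: l eps => [|p l IH] eps /=.
  by rewrite /rad_sum !big_nil mulr0 expR0.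
case/andP=> pl ul; rewrite big_cons.
have key b : avg l (fun e => expR (t * rad_sum (p :: l) a e)) (upd eps p b) =
    expR (t * ((-1) ^+ b * a p)) *
    \prod_(q <- l) ((expR (t * a q) + expR (- (t * a q))) / 2).
  rewrite -(IH (upd eps p b)) // -avgZ; apply: eq_avg => e he.
  by rewrite /rad_sum big_cons mulrDr expRD he // /upd eqxx.
rewrite /avg1 !key /= expr0 expr1 mul1r mulN1r mulrN -mulrDl.
by rewrite mulrAC.
Qed.

(** This is [1 - v <= expR (- v)] multiplied by [expR v]. *)
Lemma expR_le_of_mul (v c : R) : v < 1 -> 1 <= c * (1 - v) -> expR v <= c.
Proof.
move=> v1 hc; have v0 : 0 < 1 - v by rewrite subr_gt0.
rewrite -(ler_pM2r v0) (le_trans _ hc) //.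
rewrite -(ler_pM2l (expR_gt0 (- v))) mulrA -expRD addNr expR0 mul1r mulr1.
exact: expR_ge1Dx.
Qed.

(** Squaring [1 + v / 2 <= expR (v / 2)] at [v = u] and [v = - u] bounds the cosine below by
    [1 + u ^+ 2 / 4], which dominates [expR (u ^+ 2 / 8)] when [u ^+ 2 <= 1]. *)
Lemma cosh_ge (u : R) : `|u| <= 1 -> expR (u ^+ 2 / 8) <= (expR u + expR (- u)) / 2.
Proof.
rewrite ler_norml => /andP[u1 u2].
have sq (v : R) : -1 <= v <= 1 -> 1 + v + v ^+ 2 / 4 <= expR v.
  move=> /andP[v1 v2].
  have -> : expR v = expR (v / 2) ^+ 2 by rewrite expr2 -expRD; congr expR; field.
  have -> : 1 + v + v ^+ 2 / 4 = (1 + v / 2) ^+ 2 by field.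
  rewrite ler_pXn2r ?nnegrE ?expR_ge0 ?expR_ge1Dx //; lra.
have h1 : 1 + u + u ^+ 2 / 4 <= expR u by apply: sq; rewrite u1.
have h2 : 1 - u + u ^+ 2 / 4 <= expR (- u).
  by rewrite -(sqrrN u); apply: sq; lra.
have w0 := sqr_ge0 u.
have w1 : u ^+ 2 <= 1 by rewrite -real_normK ?num_real // expr_le1 // ler_norml u1.
have : expR (u ^+ 2 / 8) <= 1 + u ^+ 2 / 4.
  apply: expR_le_of_mul; first by lra.
  have : 0 <= u ^+ 2 / 8 * (1 - u ^+ 2 / 4) by apply: mulr_ge0; lra.
  lra.
lra.
Qed.

Lemma cosh_le (u : R) : `|u| <= 2^-1 -> (expR u + expR (- u)) / 2 <= expR (2 * u ^+ 2).
Proof.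
rewrite ler_norml => /andP[u1 u2].
have sq (v : R) : - 2^-1 <= v <= 2^-1 -> expR v <= 1 + v + 2 * v ^+ 2.
  move=> /andP[v1 v2]; apply: expR_le_of_mul; first by lra.
  have : 0 <= v ^+ 2 * (1 - 2 * v) by apply: mulr_ge0; rewrite ?sqr_ge0 //; lra.
  lra.
have h1 : expR u <= 1 + u + 2 * u ^+ 2 by apply: sq; rewrite u1.
have h2 : expR (- u) <= 1 - u + 2 * u ^+ 2.
  by rewrite -(sqrrN u); apply: sq; lra.
have := expR_ge1Dx (2 * u ^+ 2).
lra.
Qed.

(** The Paley-Zygmund ratio [m ^+ 2 / (4 * m2)], where, with [T = 16 * K], [m = expR (T ^+ 2 / 8)]
    bounds the mean of Z below and [m2 = expR (8 * T ^+ 2)] bounds its second moment above. *)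
Definition rad_tail (K : R) : R :=
  expR ((16 * K) ^+ 2 / 8) ^+ 2 / (4 * expR (8 * (16 * K) ^+ 2)).

Lemma rad_tail_gt0 K : 0 < rad_tail K.
Proof. by rewrite divr_gt0 ?exprn_gt0 ?mulr_gt0 ?expR_gt0. Qed.

(* Paley-Zygmund for [Z = expR (t * S)], without square roots:
   [Z <= theta + Z^2 / (2 B) + B / 2 * 1_{Z > theta}] for every [B > 0]. *)
Lemma rad_sum_gt l a K eps : uniq l -> 1 <= K ->
  0 < \sum_(p <- l) a p ^+ 2 ->
  (forall p, p \in l -> 4096 * K ^+ 2 * a p ^+ 2 <= \sum_(q <- l) a q ^+ 2) ->
  rad_tail K <= avg l (fun e =>
    (K * Num.sqrt (\sum_(p <- l) a p ^+ 2) < rad_sum l a e)%R%:R) eps.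
Proof.
move=> ul K1; set V := \sum_(p <- l) a p ^+ 2 => V0 small.
have sV0 : 0 < Num.sqrt V by rewrite sqrtr_gt0.
have sVV : Num.sqrt V ^+ 2 = V by rewrite sqr_sqrtr ?ltW.
set s := Num.sqrt V in sV0 sVV *.
(* With this [T], [T ^+ 2 / 8 = 2 * (T * K)]. So where the sum is at most [K * s], Z is at most
   [expR (T * K)], which is below [m / 2]. *)
pose T := 16 * K; pose t := T / s.
have T0 : 0 < T by rewrite /T; lra.
have t0 : 0 < t by rewrite divr_gt0.
have ts : t * s = T by rewrite /t divfK // gt_eqF.
have t2V : t ^+ 2 * V = T ^+ 2 by rewrite -sVV -exprMn ts.
(* Since [4096 * K ^+ 2 = 16 * T ^+ 2], each [t * a p] is at most 1/4 in absolute value: [cosh_ge]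
   applies to it and [cosh_le] to its double. *)
have smallt p : p \in l -> 16 * (t * a p) ^+ 2 <= 1.
  move=> /small h; rewrite -(ler_pM2l V0) mulr1.
  rewrite (_ : V * _ = 16 * (t ^+ 2 * V) * a p ^+ 2); last by ring.
  by rewrite t2V /T; apply: le_trans h; rewrite le_eqVlt; apply/orP; left; apply/eqP; ring.
pose m := expR (T ^+ 2 / 8); pose m2 := expR (8 * T ^+ 2).
have m0 : 0 < m by exact: expR_gt0.
have m20 : 0 < m2 by exact: expR_gt0.
have sumt (c : R) : \sum_(p <- l) c * (t * a p) ^+ 2 = c * T ^+ 2.
  rewrite -mulr_sumr; congr (_ * _); rewrite -t2V /V mulr_sumr.
  by apply: eq_bigr => p _; rewrite exprMn.
have EZ : m <= avg l (fun e => expR (t * rad_sum l a e)) eps.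
  rewrite avg_expR_rad_sum // /m mulrC -sumt expR_sum big_seq [leRHS]big_seq.
  apply: ler_prod => p pl; rewrite expR_ge0 /= mulrC; apply: cosh_ge.
  by rewrite -(@ler_pXn2r _ 2) ?nnegrE ?normr_ge0 // expr1n -normrX ger0_norm ?sqr_ge0 //;
    have := smallt p pl; have := sqr_ge0 (t * a p); lra.
have EZ2 : avg l (fun e => expR (t * rad_sum l a e) ^+ 2) eps <= m2.
  rewrite [leLHS](_ : _ = avg l (fun e => expR ((2 * t) * rad_sum l a e)) eps); last first.
    by apply: eq_avg => e _; rewrite expr2 -expRD; congr expR; ring.
  rewrite avg_expR_rad_sum // /m2 -sumt expR_sum big_seq [leRHS]big_seq.
  apply: ler_prod => p pl; rewrite divr_ge0 ?addr_ge0 ?expR_ge0 //=.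
  rewrite (_ : 8 * _ = 2 * (2 * t * a p) ^+ 2); last by ring.
  apply: cosh_le; rewrite -(@ler_pXn2r _ 2) ?nnegrE ?normr_ge0 ?invr_ge0 //.
  rewrite -normrX ger0_norm ?sqr_ge0 //; have := smallt p pl.
  by rewrite !exprMn; lra.
set Pr := avg l _ eps.
(* The threshold is [m / 2], and this [B] turns the quadratic term into [m / 4], which leaves
   [m / 4 <= Pr * (m2 / m)]. *)
pose B := 2 * m2 / m; have B0 : 0 < B by rewrite divr_gt0 ?mulr_gt0.
have : m <= m / 2 + m2 / (2 * B) + B / 2 * Pr.
  apply: (le_trans EZ); apply: (@le_trans _ _ (avg l (fun e =>
    m / 2 + ((2 * B)^-1 * expR (t * rad_sum l a e) ^+ 2 +
    B / 2 * (K * s < rad_sum l a e)%R%:R)) eps)).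
    apply: avg_le => e _.
    set Z := expR _; have Z0 : 0 < Z by exact: expR_gt0.
    case: (ltP (K * s)) => h.
      rewrite mulr1; have : Z <= (2 * B)^-1 * Z ^+ 2 + B / 2.
        rewrite -subr_ge0 (_ : _ - _ = (Z - B) ^+ 2 / (2 * B)); last by field; rewrite gt_eqF.
        by rewrite divr_ge0 ?sqr_ge0 // mulr_ge0 // ltW.
      lra.
    have : Z <= m / 2.
      have : Z <= expR (T ^+ 2 / 8 - 1).
        rewrite ler_expR; apply: (@le_trans _ _ (t * (K * s))); first by rewrite ler_pM2l.
        rewrite (_ : t * _ = (t * s) * K); last by ring.
        rewrite ts (_ : T ^+ 2 / 8 - 1 = T * K + (T * K - 1)); last by rewrite /T; field.
        by rewrite lerDl subr_ge0 /T -mulrA; apply: le_trans (_ : K * K <= _);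
          [rewrite -[leLHS]mulr1 ler_pM//; lra|have := sqr_ge0 K; lra].
      move=> /le_trans; apply; rewrite expRD -/m ler_pM2l // expRN lef_pV2 ?posrE ?expR_gt0 //.
      by have := expR_ge1Dx (1 : R); lra.
    have : 0 <= (2 * B)^-1 * Z ^+ 2 by rewrite mulr_ge0 ?invr_ge0 ?sqr_ge0 // mulr_ge0 // ltW.
    rewrite mulr0; lra.
  rewrite avgD avg_cst avgD !avgZ -/Pr -addrA lerD2l lerD2r [leRHS]mulrC.
  by rewrite ler_pM2l // invr_gt0 mulr_gt0.
have -> : m2 / (2 * B) = m / 4 by rewrite /B; field; rewrite !gt_eqF.
have -> : B / 2 * Pr = Pr * (m2 / m) by rewrite /B; field; rewrite gt_eqF.
rewrite /rad_tail -/T -/m -/m2 => h.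
have : m / 4 <= Pr * (m2 / m) by lra.
rewrite -ler_pdivrMr ?divr_gt0 // => /(le_trans _); apply.
by rewrite le_eqVlt; apply/orP; left; apply/eqP; field; rewrite !gt_eqF.
Qed.

Lemma rad_sumN l a eps : rad_sum l (fun p => - a p) eps = - rad_sum l a eps.
Proof. by rewrite /rad_sum -sumrN; apply: eq_bigr => p _; rewrite mulrN. Qed.

Lemma rad_sum_lt l a K eps : uniq l -> 1 <= K ->
  0 < \sum_(p <- l) a p ^+ 2 ->
  (forall p, p \in l -> 4096 * K ^+ 2 * a p ^+ 2 <= \sum_(q <- l) a q ^+ 2) ->
  rad_tail K <= avg l (fun e =>
    (rad_sum l a e < - (K * Num.sqrt (\sum_(p <- l) a p ^+ 2)))%R%:R) eps.
Proof.
move=> ul K1; have -> : \sum_(p <- l) a p ^+ 2 = \sum_(p <- l) (- a p) ^+ 2.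
  by apply: eq_bigr => p _; rewrite sqrrN.
move=> V0 small.
have := @rad_sum_gt l (fun p => - a p) K eps ul K1 V0.
under eq_avg do rewrite rad_sumN ltrNr; apply => p pl.
by rewrite sqrrN (le_trans _ (small p pl)).
Qed.

End RademacherSums.

(** * Primes and reciprocal sums *)

Section Primes.
Local Open Scope nat_scope.

Definition primes_in (a b : nat) : seq nat :=
  [seq p <- index_iota a.+1 b.+1 | prime p].

Lemma mem_primes_in a b p : (p \in primes_in a b) = [&& prime p, a < p & p <= b].
Proof. by rewrite mem_filter mem_index_iota. Qed.

Lemma primes_in_uniq a b : uniq (primes_in a b).
Proof. by rewrite filter_uniq // iota_uniq. Qed.

Lemma primes_in_cat a b c : a <= b -> b <= c ->
  primes_in a c = primes_in a b ++ primes_in b c.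
Proof.
move=> ab bc; rewrite /primes_in -filter_cat; congr ([seq p <- _ | prime p]).
by rewrite /index_iota -[in X in _ ++ X](_ : a.+1 + (b.+1 - a.+1) = b.+1) -?iotaD;
  [congr iota; lia|lia].
Qed.

Lemma dvdn_fact_prime p n : prime p -> (p %| n`!) = (p <= n).
Proof.
move=> pp; apply/idP/idP => [|pn]; last by rewrite dvdn_fact // prime_gt0.
elim: n => [|n IH]; first by rewrite fact0 Euclid_dvd1.
by rewrite factS Euclid_dvdM // => /orP[/dvdn_leq->//|/IH/leqW].
Qed.

(** From n to n + 1 the right side is multiplied by (4n + 2) / n, which exceeds 4. *)
Lemma central_bin_ge n : 0 < n -> 4 ^ n <= n.*2 * 'C(n.*2, n).
Proof.
elim: n => // [[|n] IH] _ //.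
have e1 : n.+2 * 'C(n.+2.*2, n.+2) = (n.+1).*2.+1.*2 * 'C(n.+1.*2, n.+1).
  have h1 := mul_bin_diag (n.+2.*2) n.+1.
  have h2 := mul_bin_down (n.+1.*2.+1) n.+1.
  have e : n.+2.*2.-1 = n.+1.*2.+1 by lia.
  have e' : n.+1.*2.+1 - n.+1 = n.+2 by lia.
  rewrite e in h1; rewrite /= e' in h2.
  move: h1 h2; set X := 'C(_, n.+2); set W := 'C(n.+1.*2, _); set Z := 'C(_, n.+1).
  by move=> h1 h2; rewrite -h1 -!doubleMl h2.
have IH' := IH isT.
have -> : n.+2.*2 * 'C(n.+2.*2, n.+2) = 2 * (n.+2 * 'C(n.+2.*2, n.+2)) by lia.
rewrite e1; apply: leq_trans (_ : 4 * (n.+1.*2 * 'C(n.+1.*2, n.+1)) <= _).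
  by rewrite expnS leq_mul2l IH'.
by rewrite !mulnA leq_mul2r; apply/orP; right; lia.
Qed.

Lemma sum_nat_leq_minn m t : \sum_(1 <= k < m.+1) (k <= t) = minn m t.
Proof.
elim: m => [|m IHm]; first by rewrite big_geq // min0n.
by rewrite big_nat_recr //= IHm; lia.
Qed.

(** Legendre's formula: each power p^k adds floor(2n / p^k) - 2 floor(n / p^k) to the exponent. This
    is at most 1, and it is 0 once p^k exceeds 2n. *)
Lemma pfactor_central_bin_le p n : prime p -> 0 < n ->
  p ^ logn p 'C(n.*2, n) <= n.*2.
Proof.
move=> pp n0; have p1 := prime_gt1 pp.
apply: leq_trans (trunc_logP p1 (_ : 0 < n.*2)); last by rewrite double_gt0.
rewrite leq_exp2l //; set t := trunc_log _ _.
have nn : n <= n.*2 by rewrite -addnn leq_addr.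
have := bin_fact nn; rewrite (_ : n.*2 - n = n); last by lia.
move=> /(congr1 (logn p)).
rewrite lognM ?bin_gt0 ?muln_gt0 ?fact_gt0 // lognM ?fact_gt0 //.
have fact_ext m : m <= n.*2 -> logn p m`! = \sum_(1 <= k < n.*2.+1) m %/ p ^ k.
  move=> mn; rewrite logn_fact // [in RHS](@big_cat_nat _ _ _ m.+1) //=
    [X in _ = _ + X]big1_seq ?addn0 //.
  move=> k; rewrite mem_index_iota => /andP[_ /andP[mk _]].
  by rewrite divn_small // (leq_trans mk) // ltnW // ltn_expl.
rewrite !fact_ext // => h.
have : logn p 'C(n.*2, n) <= \sum_(1 <= k < n.*2.+1) (k <= t).
  rewrite -(leq_add2r (\sum_(1 <= k < n.*2.+1) n %/ p ^ k +
    \sum_(1 <= k < n.*2.+1) n %/ p ^ k)).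
  rewrite h -!big_split /=; apply: leq_sum => k _.
  case: (leqP k t) => kt.
    by rewrite -addnn divnD ?expn_gt0 ?(ltnW p1) //; lia.
  rewrite (_ : n.*2 %/ p ^ k = 0) ?leq0n // divn_small //.
  by apply: leq_trans (trunc_log_ltn n.*2 p1) _; rewrite leq_exp2l.
move/leq_trans; apply.
by rewrite sum_nat_leq_minn geq_minr.
Qed.

Lemma central_bin_le n : 0 < n ->
  'C(n.*2, n) <= n.*2 ^ size (primes_in 0 n.*2).
Proof.
move=> n0; have C0 : 0 < 'C(n.*2, n) by rewrite bin_gt0 -addnn leq_addr.
rewrite [leqLHS](prod_prime_decomp C0) prime_decompE big_map /=.
apply: leq_trans (_ : \prod_(p <- primes 'C(n.*2, n)) n.*2 <= _).
  rewrite big_seq [leqRHS]big_seq; apply: leq_prod => p.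
  by rewrite mem_primes => /andP[pp _]; exact: pfactor_central_bin_le.
rewrite big_const_seq count_predT iter_muln_1 leq_exp2l; last by lia.
apply: uniq_leq_size; first exact: primes_uniq.
move=> p; rewrite mem_primes mem_primes_in => /and3P[pp _ pC].
rewrite pp prime_gt0 //= -dvdn_fact_prime //.
have := bin_fact (_ : n <= n.*2); rewrite -addnn leq_addr => /(_ isT) <-.
by rewrite addnn dvdn_mulr.
Qed.

(** Chebyshev's bound: with 2n = 2^i, 4^n is at most 2n times the central binomial coefficient,
    hence at most (2n)^(1 + pi(2n)). Exponents of 2 are then compared. *)
Lemma primes_in_pow2 i : 0 < i -> 2 ^ i <= i * (size (primes_in 0 (2 ^ i))).+1.
Proof.
case: i => // i _; have n0 : 0 < 2 ^ i by rewrite expn_gt0.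
have e : (2 ^ i).*2 = 2 ^ i.+1 by rewrite expnS mul2n.
have := central_bin_ge n0; have := central_bin_le n0; rewrite e => h1 h2.
rewrite -(leq_exp2l (m := 2)) // -{1}e -mul2n expnM (leq_trans h2) //.
by rewrite (expnM 2) [leqRHS]expnS leq_mul2l h1 orbT.
Qed.

(** Discarding the at most 2^(3e) smaller primes costs no more than half of the count, because
    [4 * i <= 2 ^ (i - 3 * e)]. *)
Lemma primes_in_mid e i : 8 <= e -> 4 * e <= i ->
  2 ^ i <= 2 * i * size (primes_in (2 ^ (3 * e)) (2 ^ i)).
Proof.
move=> e8 ei; have i0 : 0 < i by lia.
have ei' : 2 ^ (3 * e) <= 2 ^ i by rewrite leq_exp2l //; lia.
have := primes_in_pow2 i0; rewrite (primes_in_cat (leq0n _) ei') size_cat.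
have s1 : size (primes_in 0 (2 ^ (3 * e))) <= 2 ^ (3 * e).
  by rewrite size_filter (leq_trans (count_size _ _)) // size_iota subn1.
have : 4 * i <= 2 ^ (i - 3 * e).
  pose r := i - 4 * e; rewrite (_ : i - 3 * e = e + r); last by rewrite /r; lia.
  have -> : i = 4 * e + r by rewrite /r; lia.
  rewrite expnD; apply: leq_trans (_ : (16 * e) * r.+1 <= _); first by nia.
  apply: leq_mul; last exact: ltn_expl.
  have : 2 ^ (e - 8) >= (e - 8).+1 by apply: ltn_expl.
  have -> : 2 ^ e = 2 ^ 8 * 2 ^ (e - 8) by rewrite -expnD; congr (_ ^ _); lia.
  rewrite (_ : 2 ^ 8 = 256) //; lia.
have <- : 2 ^ (3 * e) * 2 ^ (i - 3 * e) = 2 ^ i by rewrite -expnD; congr (_ ^ _); lia.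
have : 0 < 2 ^ (3 * e) by rewrite expn_gt0.
move: (2 ^ (3 * e)) (2 ^ (i - 3 * e)) (size _) (size _) s1 => a b s s'.
nia.
Qed.

End Primes.

Section ReciprocalSums.
Variable R : realType.

Lemma sum_inv_telescope a b : (0 < a)%N -> (a <= b)%N ->
  \sum_(a <= n < b) (n * n.+1)%:R^-1 = a%:R^-1 - b%:R^-1 :> R.
Proof.
move=> a0 ab; rewrite (eq_big_nat _ _ (F2 := fun n => n%:R^-1 - n.+1%:R^-1)).
  rewrite (@telescope_sumr_eq _ _ _ (fun n => - (n%:R^-1 : R))) //;
    first by rewrite opprK addrC.
  by move=> k _; rewrite opprK addrC.
move=> n /andP[an _]; have n0 : (n%:R != 0 :> R) by rewrite pnatr_eq0; lia.
by rewrite natrM -natr1; field; rewrite n0 natr1 pnatr_eq0.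
Qed.

Lemma harmonic_pow2 e : \sum_(1 <= d < (2 ^ e).+1) d%:R^-1 <= 1 + e%:R :> R.
Proof.
elim: e => [|e IH]; first by rewrite expn0 big_nat1 invr1 addr0.
rewrite (@big_cat_nat _ _ _ (2 ^ e).+1) //=; last by rewrite ltnS leq_exp2l.
rewrite -natr1 addrA lerD //.
apply: le_trans (_ : \sum_((2 ^ e).+1 <= i < (2 ^ e.+1).+1) (2 ^ e)%:R^-1 <= _).
  apply: ler_sum_nat => i /andP[h _].
  by rewrite lef_pV2 ?posrE ?ltr0n ?ler_nat ?expn_gt0 //; lia.
rewrite sumr_const_nat (_ : (_ - _ = 2 ^ e)%N); last by rewrite expnS; lia.
by rewrite -[leLHS]mulr_natr mulVf // pnatr_eq0 expn_eq0.
Qed.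

(** Summation by parts in dyadic form: 1/p is bounded below by a sum over the powers of 2 that are
    at least p, which turns reciprocal sums into prime counts. *)
Lemma sum_dyadic_le p b : (0 < p)%N ->
  \sum_(0 <= i < b) (p <= 2 ^ i)%N%:R / (2 ^ i.+1)%:R
   <= if (p <= 2 ^ b)%N then p%:R^-1 - (2 ^ b)%:R^-1 else 0 :> R.
Proof.
move=> p0; elim: b => [|b IH].
  rewrite big_geq // expn0; case: ifP => // p1.
  by rewrite (_ : p = 1%N) ?subrr //; lia.
rewrite big_nat_recr //=.
have p2 : (0 < 2 ^ b)%N by rewrite expn_gt0.
have pR : (0 < (2 ^ b)%:R :> R) by rewrite ltr0n.
have e : ((2 ^ b.+1)%:R^-1 = 2^-1 * (2 ^ b)%:R^-1 :> R).
  by rewrite expnS natrM invfM.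
move: IH; case: leqP => h IH.
  rewrite (_ : (p <= 2 ^ b.+1)%N); last by rewrite expnS; lia.
  rewrite mul1r e; lra.
rewrite mul0r addr0 (le_trans IH) //; case: ifP => // h'.
by rewrite subr_ge0 lef_pV2 ?posrE ?ltr0n ?expn_gt0 // ler_nat.
Qed.

(** After exchanging the sums, each of the 4e exponents i in [4e, 8e) contributes at least 1 / (4i),
    hence at least 1 / (32e). *)
Lemma mertens_lower e : (8 <= e)%N ->
  8^-1 <= \sum_(p <- primes_in (2 ^ (3 * e)) (2 ^ (8 * e))) p%:R^-1 :> R.
Proof.
move=> e8; set l := primes_in _ _.
apply: le_trans (_ : \sum_(p <- l) \sum_(0 <= i < 8 * e)
  (p <= 2 ^ i)%N%:R / (2 ^ i.+1)%:R <= _); last first.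
  rewrite big_seq [leRHS]big_seq; apply: ler_sum => p; rewrite mem_primes_in => /and3P[pp _ pb].
  apply: le_trans (sum_dyadic_le _ (prime_gt0 pp)) _; rewrite pb.
  by rewrite gerBl invr_ge0 ler0n.
rewrite exchange_big /= (@big_cat_nat _ _ _ (4 * e)) //=; last by lia.
apply: le_trans (_ : \sum_(4 * e <= i < 8 * e) (32 * e)%:R^-1 <= _).
  rewrite sumr_const_nat -mulr_natr (_ : (8 * e - 4 * e = 4 * e)%N); last by lia.
  rewrite !natrM; have e0 : (0 < e%:R :> R) by rewrite ltr0n; lia.
  by rewrite le_eqVlt; apply/orP; left; apply/eqP; field; rewrite gt_eqF.
rewrite -[leLHS]add0r lerD //.
  by apply: sumr_ge0 => i _; apply: sumr_ge0 => p _; rewrite divr_ge0 ?ler0n.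
apply: ler_sum_nat => i /andP[i1 i2].
rewrite -mulr_suml -natr_sum.
have -> : (\sum_(p <- l) (p <= 2 ^ i)%N = size (primes_in (2 ^ (3 * e)) (2 ^ i)))%N.
  rewrite /l (@primes_in_cat _ (2 ^ i)) ?leq_exp2l //; try lia.
  rewrite big_cat /= -!sum1_size [X in (_ + X)%N]big1_seq ?addn0; last first.
    by move=> p /=; rewrite mem_primes_in => /and3P[_ h _]; rewrite leqNgt h.
  by apply: eq_big_seq => p; rewrite mem_primes_in => /and3P[_ _ ->].
have i0 : (0 < i)%N by lia.
have := primes_in_mid e8 i1; set s := size _ => h.
rewrite ler_pdivlMr ?ltr0n ?expn_gt0 // mulrC ler_pdivrMr ?ltr0n; last by lia.
rewrite -natrM ler_nat expnS; nia.
Qed.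

End ReciprocalSums.

(** * Random multiplicative sums *)

(* [chi] is the support of h: all integers for f, the squarefree ones for g. *)
Definition support_ok (chi : pred nat) : Prop :=
  chi 1%N /\ forall p m, prime p -> (0 < m)%N -> ~~ (p %| m)%N ->
    chi (p * m)%N = chi m.

Lemma big_dvdn (R : realType) (q : nat) (G : nat -> R) x : (0 < q)%N ->
  \sum_(1 <= n < x.+1 | (q %| n)%N) G n =
  \sum_(1 <= m < (x %/ q).+1) G (q * m)%N.
Proof.
move=> q0; elim: x => [|x IH]; first by rewrite div0n !big_geq.
rewrite big_mkcond big_nat_recr //= -big_mkcond IH divnS //.
case: (boolP (q %| x.+1)%N) => [qx|_]; last by rewrite addr0 add0n.
rewrite add1n [in RHS]big_nat_recr //=; congr (_ + G _).
by have := divnK qx; rewrite divnS // qx add1n mulnC => ->.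
Qed.

Section RandomSums.
Variables (R : realType) (chi : pred nat).
Hypothesis chiP : support_ok chi.
Implicit Types (eps : signs) (l : seq nat).

(** Prime factors of [n] with sign -1, counted with multiplicity; composite indices drop out because
    [logn] vanishes there. *)
Definition odd_primes eps n : nat := (\sum_(0 <= p < n.+1 | eps p) logn p n)%N.

Definition mulsgn eps n : R := (-1) ^+ odd_primes eps n.

Definition hval eps n : R := (chi n)%:R * mulsgn eps n.

Definition psum eps (x : nat) : R := partial_sum (hval eps) x.

Lemma odd_primes_widen eps n N : (0 < n)%N -> (n <= N)%N ->
  odd_primes eps n = (\sum_(0 <= p < N.+1 | eps p) logn p n)%N.
Proof.
move=> n0 nN; rewrite /odd_primes [RHS](@big_cat_nat _ _ _ n.+1) //=.
rewrite [X in (_ + X)%N]big_nat_cond [X in (_ + X)%N]big1 ?addn0 // => p /andP[/andP[np _] _].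
by rewrite lognE; case: and3P => // -[_ _ /dvdn_leq]; lia.
Qed.

Lemma mulsgnM eps m n : (0 < m)%N -> (0 < n)%N ->
  mulsgn eps (m * n) = mulsgn eps m * mulsgn eps n.
Proof.
move=> m0 n0; rewrite /mulsgn -exprD; congr (_ ^+ _).
rewrite (@odd_primes_widen _ m (m * n)) ?leq_pmulr //.
rewrite (@odd_primes_widen _ n (m * n)) ?leq_pmull // -big_split /=.
by apply: eq_bigr => p _; rewrite lognM.
Qed.

Lemma mulsgn1 eps : mulsgn eps 1 = 1.
Proof.
by rewrite /mulsgn /odd_primes big1 ?expr0 // => p _; rewrite logn1.
Qed.

Lemma mulsgn_prime eps p : prime p -> mulsgn eps p = (-1) ^+ eps p.
Proof.
move=> pp; rewrite /mulsgn /odd_primes big_mkcond /= big_nat_recr //=.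
rewrite big_nat_cond big1 ?add0n.
  by rewrite logn_prime // eqxx; case: (eps p).
by move=> q /andP[/andP[_ qp] _]; rewrite logn_prime // ltn_eqF //; case: ifP.
Qed.

Lemma mulsgn_dep eps eps' n :
  (forall p, prime p -> (p %| n)%N -> eps' p = eps p) ->
  mulsgn eps' n = mulsgn eps n.
Proof.
move=> h; congr (_ ^+ _); rewrite /odd_primes big_mkcond [RHS]big_mkcond /=.
apply: eq_bigr => p _; rewrite lognE.
by case: and3P => [[pp _ /(h p pp) ->] //|_]; do 2 case: ifP.
Qed.

Lemma hval_dep eps eps' n :
  (forall p, prime p -> (p %| n)%N -> eps' p = eps p) -> hval eps' n = hval eps n.
Proof. by move=> h; rewrite /hval (mulsgn_dep h). Qed.

Lemma psum_dep eps eps' x :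
  (forall p, prime p -> (p <= x)%N -> eps' p = eps p) -> psum eps' x = psum eps x.
Proof.
move=> h; apply: eq_big_nat => n /andP[n0 nx]; apply: hval_dep => p pp pn.
by apply: h => //; apply: leq_trans (dvdn_leq n0 pn) _; rewrite -ltnS.
Qed.

Lemma hval1 eps : hval eps 1 = 1.
Proof. by rewrite /hval mulsgn1 mulr1 (proj1 chiP). Qed.

Lemma psum0 eps : psum eps 0 = 0.
Proof. by rewrite /psum /partial_sum big_geq. Qed.

Lemma psum1 eps : psum eps 1 = 1.
Proof. by rewrite /psum /partial_sum big_nat1 hval1. Qed.

Lemma normr_hval_le eps n : `|hval eps n| <= 1.
Proof.
by rewrite /hval normrM /mulsgn normrX normrN normr1 expr1n mulr1 normr_nat lern1; case: (chi n).
Qed.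

Lemma normr_psum_le eps x : `|psum eps x| <= x%:R.
Proof.
apply: le_trans (ler_norm_sum _ _ _) _.
apply: le_trans (_ : \sum_(1 <= n < x.+1) 1 <= _).
  by apply: ler_sum => n _; exact: normr_hval_le.
by rewrite sumr_const_nat subn1.
Qed.

Lemma sqr_psum_le eps x y : (x <= y)%N -> psum eps x ^+ 2 <= (y ^ 2)%:R.
Proof.
move=> xy; rewrite natrX -real_normK ?num_real // ler_pXn2r ?nnegrE ?ler0n //.
by apply: le_trans (normr_psum_le _ _) _; rewrite ler_nat.
Qed.

(* If [q, p] in [l] both divided [n <= x] then [q <= x / p <= y < q]. *)
Lemma psum_split eps x y l : uniq l ->
  (forall p, p \in l -> [&& prime p, y < p & x %/ p <= y]%N) ->
  psum eps x = \sum_(1 <= n < x.+1 | all (fun p => ~~ (p %| n)%N) l) hval eps n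
    + rad_sum l (fun p => psum eps (x %/ p)) eps.
Proof.
elim: l => [|p l IH] /= => [_ _|/andP[pl ul] h].
  by rewrite /rad_sum big_nil addr0.
have {}IH := IH ul (fun q ql => h q (mem_behead (s := p :: l) ql)).
have /and3P[pp yp xp] := h p (mem_head _ _).
rewrite IH {IH} /rad_sum big_cons addrA; congr (_ + _).
(* The terms divisible by [p] but by no prime of [l] are the [p * m] with [m <= x %/ p]; they are
   peeled off as the summand of [p]. *)
rewrite (bigID (fun n => (p %| n)%N)) /= addrC; congr (_ + _).
  by apply: eq_bigl => n; rewrite andbC.
rewrite (eq_bigl (fun n => (p %| n)%N && all (fun q => ~~ (q %| n)%N) l)); last first.
  by move=> n; rewrite andbC.
rewrite big_mkcondr big_dvdn ?prime_gt0 // /psum /partial_sum mulr_sumr.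
apply: eq_big_nat => m /andP[m0 mx].
have small q : (y < q)%N -> ~~ (q %| m)%N.
  by move=> yq; apply/negP => /(dvdn_leq m0); lia.
rewrite ifT; last first.
  apply/allP => q ql; have /and3P[pq yq _] := h q (mem_behead (s := p :: l) ql).
  rewrite Euclid_dvdM // negb_or small // andbT dvdn_prime2 //.
  by apply: contraNneq pl => <-.
rewrite /hval (proj2 chiP) ?small // (mulsgnM _ (prime_gt0 pp) m0) mulsgn_prime //.
by rewrite mulrCA.
Qed.

(* Discrete form of the integral of M(u)^2 / u^2 over [1, y + 1]. *)
Definition energy eps (y : nat) : R :=
  \sum_(1 <= x < y.+1) psum eps x ^+ 2 / (x * x.+1)%:R.

Lemma energy_dep eps eps' y :
  (forall p, prime p -> (p <= y)%N -> eps' p = eps p) -> energy eps' y = energy eps y.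
Proof.
move=> h; apply: eq_big_nat => x /andP[_ xy]; congr (_ ^+ 2 / _).
by apply: psum_dep => p pp px; apply: h => //; lia.
Qed.

Lemma energy_term_ge0 eps x : 0 <= psum eps x ^+ 2 / (x * x.+1)%:R.
Proof. by rewrite divr_ge0 ?sqr_ge0 ?ler0n. Qed.

Lemma energy_ge eps y : (0 < y)%N -> 2^-1 <= energy eps y.
Proof.
move=> y0; rewrite /energy big_ltn // psum1 expr1n mul1r lerDl.
by apply: sumr_ge0 => x _; exact: energy_term_ge0.
Qed.

Lemma energy_mono eps y y' : (y <= y')%N -> energy eps y <= energy eps y'.
Proof.
move=> yy; rewrite /energy [leRHS](@big_cat_nat _ _ _ y.+1) //= lerDl.
by apply: sumr_ge0 => x _; exact: energy_term_ge0.
Qed.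

(* Exact, since 1 / (x (x + 1)) telescopes over the p integers x with x / p = m. *)
Lemma energy_dilate eps p y : (0 < p)%N ->
  \sum_(p <= x < p * y.+1) psum eps (x %/ p) ^+ 2 / (x * x.+1)%:R =
  p%:R^-1 * energy eps y.
Proof.
move=> p0; rewrite /energy; elim: y => [|y IH].
  by rewrite muln1 !big_geq // mulr0.
rewrite (@big_cat_nat _ _ _ (p * y.+1)) /= ?leq_pmulr ?leq_mul // IH.
rewrite [in RHS]big_nat_recr //= mulrDr; congr (_ + _).
rewrite (eq_big_nat _ _ (F2 := fun x => psum eps y.+1 ^+ 2 * (x * x.+1)%:R^-1)); last first.
  move=> x /andP[x1 x2]; congr (psum _ _ ^+ 2 / _); apply/eqP.
  by rewrite eqn_leq -ltnS ltn_divLR // leq_divRL // [in X in _ && X]mulnC x1 mulnC x2.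
rewrite -mulr_sumr sum_inv_telescope ?muln_gt0 ?p0 ?leq_mul //.
rewrite !natrM -[y.+2%:R]natr1.
have pR : (0 < p%:R :> R) by rewrite ltr0n.
have : (0 < y.+1%:R :> R) by rewrite ltr0n.
move: y.+1%:R (psum eps y.+1) => a b a0; field.
by rewrite !gt_eqF // ltr_wpDr.
Qed.

Variable e : nat.

(* The primes whose signs enter [psum eps x] linearly, with coefficients
   [psum eps (x %/ p)] that only involve the primes up to [2 ^ e]. *)
Definition block x :=
  [seq p <- primes_in (2 ^ (3 * e)) (2 ^ (8 * e)) | (x %/ p <= 2 ^ e)%N].

Definition block_var eps x : R := \sum_(p <- block x) psum eps (x %/ p) ^+ 2.

Lemma block_uniq x : uniq (block x).
Proof. by rewrite filter_uniq // primes_in_uniq. Qed.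

Lemma mem_block x p : p \in block x ->
  [/\ prime p, (2 ^ (3 * e) < p)%N, (p <= 2 ^ (8 * e))%N & (x %/ p <= 2 ^ e)%N].
Proof. by rewrite mem_filter mem_primes_in => /and4P[]. Qed.

Lemma block_sub x : {subset block x <= primes_in (2 ^ e) (2 ^ (10 * e))}.
Proof.
move=> p /mem_block[pp p1 p2 _]; rewrite mem_primes_in pp.
by rewrite (leq_ltn_trans _ p1) ?(leq_trans p2) // leq_exp2l //; lia.
Qed.

Lemma block_var_ge0 eps x : 0 <= block_var eps x.
Proof. by apply: sumr_ge0 => p _; exact: sqr_ge0. Qed.

(** For smaller [x] every quotient [x %/ p] is 0. A positive variance thus places [x] beyond the
    scale [2 ^ e]. *)
Lemma block_var_gt0 eps x : 0 < block_var eps x -> (2 ^ (3 * e) < x)%N.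
Proof.
rewrite ltNge => /negP h; rewrite ltnNge; apply/negP => xe; apply: h.
rewrite /block_var big_seq big1 // => p /mem_block[_ p1 _ _].
by rewrite divn_small ?psum0 ?expr0n // (leq_ltn_trans xe).
Qed.

(** For fixed p the x with 1 <= x / p <= y fill [p, p (y + 1)), so [energy_dilate] gives the energy
    divided by p; [mertens_lower] then sums over p. *)
Lemma block_mass eps : (8 <= e)%N ->
  energy eps (2 ^ e) / 8 <=
  \sum_(1 <= x < (2 ^ (10 * e)).+1) block_var eps x / (x * x.+1)%:R.
Proof.
move=> e8; set y := (2 ^ e)%N; set l := primes_in (2 ^ (3 * e)) (2 ^ (8 * e)).
apply: le_trans (_ : \sum_(p <- l) p%:R^-1 * energy eps y <= _).
  rewrite -mulr_suml mulrC ler_wpM2r ?mertens_lower //.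
  by apply: sumr_ge0 => x _; exact: energy_term_ge0.
rewrite [leRHS](eq_bigr (fun x => \sum_(p <- l)
   (if (x %/ p <= y)%N then psum eps (x %/ p) ^+ 2 / (x * x.+1)%:R else 0))); last first.
  by move=> x _; rewrite /block_var mulr_suml big_filter big_mkcond.
rewrite exchange_big /= big_seq [leRHS]big_seq; apply: ler_sum => p.
rewrite mem_primes_in => /and3P[pp p1 p2]; have p0 := prime_gt0 pp.
(* The whole interval of [p] lies below the next scale, since 8e + (e + 1) <= 10e. *)
have hb : (p * y.+1 <= (2 ^ (10 * e)).+1)%N.
  apply: leqW; apply: leq_trans (_ : 2 ^ (8 * e) * 2 ^ e.+1 <= _)%N.
    by rewrite leq_mul // expnS mul2n -addnn -addn1 leq_add2l expn_gt0.
  by rewrite -expnD leq_exp2l //; lia.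
have pos x : 0 <= (if (x %/ p <= y)%N then psum eps (x %/ p) ^+ 2 / (x * x.+1)%:R else 0).
  by case: ifP => // _; rewrite divr_ge0 ?sqr_ge0 ?ler0n.
have pp1 : (p <= p * y.+1)%N by rewrite leq_pmulr.
rewrite [leRHS](@big_cat_nat _ _ _ p) //=; last by rewrite (leq_trans pp1).
rewrite [X in _ + X](@big_cat_nat _ _ _ (p * y.+1)) //=.
rewrite -energy_dilate // (eq_big_nat _ _ (F2 := fun x =>
  (if (x %/ p <= y)%N then psum eps (x %/ p) ^+ 2 / (x * x.+1)%:R else 0))).
  by rewrite addrCA lerDl addr_ge0 // sumr_ge0.
by move=> x /andP[_ x2]; rewrite ifT // -ltnS ltn_divLR // mulnC.
Qed.

End RandomSums.

(** * Forcing either sign of a sum with a symmetric part *)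

Lemma agree_off_trans l l' (eps eps' eps'' : signs) : {subset l' <= l} ->
  agree_off l eps eps' -> agree_off l' eps' eps'' -> agree_off l eps eps''.
Proof. by move=> sub h h' q ql; rewrite h' ?h //; apply: contra ql => /sub. Qed.

Section SignFlip.
Variable R : realType.
Implicit Types (l b : seq nat) (a : nat -> R) (eps : signs).

Lemma avg_rad_sum_sym b a (G : R -> R) eps : uniq b ->
  avg b (fun e => G (rad_sum b a e)) eps =
  avg b (fun e => G (- rad_sum b a e)) eps.
Proof.
elim: b G eps => [|p b IH] G eps /=.
  by rewrite /rad_sum big_nil oppr0.
case/andP=> pb ub.
have E (s : R -> R) (c : bool) :
    avg b (fun e => G (s (rad_sum (p :: b) a e))) (upd eps p c) =
    avg b (fun e => G (s ((-1) ^+ c * a p + rad_sum b a e))) (upd eps p c).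
  by apply: eq_avg => e he; rewrite /rad_sum big_cons he // /upd eqxx.
have flip (c : bool) :
    avg b (fun e => G ((-1) ^+ c * a p + rad_sum b a e)) (upd eps p c) =
    avg b (fun e => G (- ((-1) ^+ (~~ c) * a p + rad_sum b a e))) (upd eps p (~~ c)).
  rewrite (IH (fun z => G ((-1) ^+ c * a p + z))) //.
  transitivity (avg b (fun e => G (- ((-1) ^+ (~~ c) * a p + rad_sum b a e))) (upd eps p c)).
    by apply: eq_avg => e _; rewrite signrN mulNr opprD opprK.
  apply: avg_dep => e e' _ _ ee'; congr (G (- (_ + _))).
  by apply: eq_big_seq => q qb; rewrite ee'.
by rewrite /avg1 !(E id) !(E -%R) !flip /= addrC.
Qed.

(* Given the other coordinates [Phi = Psi + S] with [S] symmetric, so [Phi] is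
   outside [-r, r] with probability at least 1/2 whenever [Psi] is; hence [Psi]
   is inside [-r, r] with probability at least 1/4, and then [S] beyond [-r]
   or [r] decides the sign of [Phi]. *)
Lemma sign_flip l b a K Phi Psi eps :
  uniq b -> {subset b <= l} -> 1 <= K ->
  0 < \sum_(p <- b) a p ^+ 2 ->
  (forall p, p \in b -> 4096 * K ^+ 2 * a p ^+ 2 <= \sum_(q <- b) a q ^+ 2) ->
  (forall e, agree_off l eps e -> Phi e = Psi e + rad_sum b a e) ->
  (forall e e', agree_off b e e' -> Psi e' = Psi e) ->
  avg (R := R) l (fun e => (K ^+ 2 * \sum_(p <- b) a p ^+ 2 < Phi e ^+ 2)%R%:R) eps <= 3 / 8 ->
  rad_tail K / 4 <= avg (R := R) l (fun e => (Phi e < 0)%R%:R) eps /\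
  rad_tail K / 4 <= avg (R := R) l (fun e => (0 < Phi e)%R%:R) eps.
Proof.
move=> ub bl K1 V0 small PhiE PsiE hP.
set V := \sum_(p <- b) a p ^+ 2 in V0 small hP *.
pose r := K * Num.sqrt V.
have r0 : 0 < r by rewrite mulr_gt0 ?sqrtr_gt0 //; lra.
have r2 : K ^+ 2 * V = r ^+ 2 by rewrite exprMn sqr_sqrtr ?ltW.
rewrite {}r2 in hP.
(* If [Psi e ^+ 2] exceeds [r ^+ 2], so does at least one of the squares of [Psi e + z] and
   [Psi e - z]. Hence the bound 3/8 for [Phi] becomes 3/4 for [Psi]. *)
have PsiP : 4^-1 <= avg (R := R) l (fun e => (Psi e ^+ 2 <= r ^+ 2)%R%:R) eps.
  have : avg (R := R) l (fun e => 2^-1 * (r ^+ 2 < Psi e ^+ 2)%R%:R) eps <= 3 / 8.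
    apply: le_trans hP; rewrite -[leRHS](avg_tower _ _ bl).
    apply: avg_le => e he.
    set g := fun z : R => ((r ^+ 2 < (Psi e + z) ^+ 2)%R%:R : R).
    have -> : avg (R := R) b (fun e0 => (r ^+ 2 < Phi e0 ^+ 2)%R%:R) e =
        avg b (fun e0 => g (rad_sum b a e0)) e.
      apply: eq_avg => e' he'; rewrite /g PhiE ?(PsiE _ _ he') //.
      exact: agree_off_trans bl he he'.
    have : (r ^+ 2 < Psi e ^+ 2)%R%:R <=
        avg b (fun e0 => g (rad_sum b a e0) + g (- rad_sum b a e0)) e.
      rewrite -[leLHS](avg_cst b _ e); apply: avg_le => e' _.
      rewrite /g; move: (rad_sum b a e') => z.
      have [h|_] := ltP (r ^+ 2) (Psi e ^+ 2); last by rewrite addr_ge0.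
      have [h1|h1] := ltP (r ^+ 2) ((Psi e + z) ^+ 2); first by rewrite lerDl.
      have [h2|h2] := ltP (r ^+ 2) ((Psi e - z) ^+ 2); first by rewrite lerDr.
      by exfalso; have := sqr_ge0 z; nra.
    rewrite avgD -avg_rad_sum_sym //; lra.
  rewrite avgZ => h.
  have : avg (R := R) l (fun e => (r ^+ 2 < Psi e ^+ 2)%R%:R + (Psi e ^+ 2 <= r ^+ 2)%R%:R) eps = 1.
    by apply: avg_const => e _; case: ltP => _; rewrite ?addr0 ?add0r.
  rewrite avgD; lra.
have rt0 := ltW (rad_tail_gt0 K).
(* The signs of [b] are averaged first, with [Psi] frozen; the tail bound is then used only where
   [Psi] lies in [-r, r]. *)
have fin (Q : signs -> bool) (Q' : signs -> bool) :
    (forall e, rad_tail K <= avg (R := R) b (fun e => (Q' e)%:R) e) ->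
    (forall e, agree_off l eps e -> Psi e ^+ 2 <= r ^+ 2 -> Q' e -> Q e) ->
    rad_tail K / 4 <= avg (R := R) l (fun e => (Q e)%:R) eps.
  move=> hQ' hQ; rewrite -[leRHS](avg_tower _ _ bl).
  apply: le_trans (_ : avg (R := R) l (fun e => rad_tail K * (Psi e ^+ 2 <= r ^+ 2)%R%:R) eps <= _).
    by rewrite avgZ ler_wpM2l.
  apply: avg_le => e he; have [hr|_] := leP (Psi e ^+ 2) (r ^+ 2); last first.
    by rewrite mulr0; apply: avg_ge0.
  rewrite mulr1; apply: le_trans (hQ' e) _; apply: avg_le => e' he'.
  rewrite ler_nat; case: (boolP (Q' e')) => // q'.
  rewrite (hQ e') //; first exact: agree_off_trans bl he he'.
  by rewrite (PsiE _ _ he').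
have absr e : Psi e ^+ 2 <= r ^+ 2 -> - r <= Psi e <= r.
  by rewrite -(real_normK (num_real (Psi e))) ler_pXn2r ?nnegrE ?normr_ge0 ?(ltW r0) // ler_norml.
split.
  apply: (fin _ (fun e => rad_sum b a e < - r)).
    by move=> e; exact: rad_sum_lt.
  by move=> e he /absr hr h; rewrite PhiE //; lra.
apply: (fin _ (fun e => r < rad_sum b a e)).
  by move=> e; exact: rad_sum_gt.
by move=> e he /absr hr h; rewrite PhiE //; lra.
Qed.

End SignFlip.

(** * Sign changes between two consecutive scales *)

Lemma rad_tail_le (R : realType) (K : R) : rad_tail K <= 4^-1.
Proof.
rewrite /rad_tail invfM mulrA ler_pdivrMr ?expR_gt0 // expr2 -expRD mulrC.
rewrite ler_pM2l ?invr_gt0 //.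
by rewrite ler_expR; have := sqr_ge0 (16 * K); lra.
Qed.

Section SignChangeCount.
Variable R : realType.
Implicit Types s t : seq R.
Local Notation changes := (@qe_rcf_th.changes R).

Lemma changes_cat_ge s t : (changes s <= changes (s ++ t))%N.
Proof.
elim: s => [//|a [|b s] IH] /=; first by rewrite mulr0 ltxx.
by rewrite leq_add2l; exact: IH.
Qed.

(** As long as adjacent products are positive the sign of the head is inherited, so the opposite
    sign of [b] forces a change on the way. *)
Lemma changes_gt0 z b t : all (fun x => x != 0) (z :: t) -> b \in t ->
  z * b < 0 -> (0 < changes (z :: t))%N.
Proof.
elim: t z => [//|c t IH] z /= /and3P[z0 c0 t0].
have [h _ _ | h] := ltP (z * c) 0; first by [].
rewrite inE => /orP[/eqP ->|bt] zb; first by rewrite ltNge h in zb.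
rewrite add0n; apply: (IH c) => //; first by rewrite /= c0.
have zc : 0 < z * c by rewrite lt_neqAle h eq_sym mulf_neq0.
have : (z * c) * (z * b) < 0 by rewrite pmulr_rlt0.
by rewrite mulrACA pmulr_rlt0 // -expr2 exprn_even_gt0.
Qed.

Lemma changes_cat_gt s t b : s != [::] -> all (fun x => x != 0) (s ++ t) ->
  b \in t -> last 0 s * b < 0 -> (changes s < changes (s ++ t))%N.
Proof.
case: s => [//|a s] _; elim: s a => [|c s IH] a.
  move=> h bt zb; rewrite [X in (X < _)%N]/= mulr0 ltxx /=.
  exact: changes_gt0 h bt zb.
move=> /= /andP[a0 h] bt zb; rewrite ltn_add2l.
exact: IH.
Qed.

End SignChangeCount.

Section Step.
Variables (R : realType) (chi : pred nat).
Hypothesis chiP : support_ok chi.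
Implicit Types (eps : signs).
Local Notation psum := (psum R chi).
Local Notation energy := (energy R chi).
Local Notation block_var := (block_var R chi).

Definition nz_sums eps y : seq R :=
  [seq z <- [seq psum eps m | m <- iota 1 y] | z != 0].

Definition nchanges eps y : nat := qe_rcf_th.changes (nz_sums eps y).

Lemma nz_sums_dep eps eps' y :
  (forall p, prime p -> (p <= y)%N -> eps' p = eps p) ->
  nz_sums eps' y = nz_sums eps y.
Proof.
move=> h; rewrite /nz_sums; congr ([seq z <- _ | z != 0]).
apply/eq_in_map => m; rewrite mem_iota => /andP[_ my].
by apply: psum_dep => p pp pm; apply: h => //; lia.
Qed.

Lemma nz_sums_cat eps y y' : (y <= y')%N -> exists2 t,
  nz_sums eps y' = nz_sums eps y ++ t &
  forall x, (y < x <= y')%N -> psum eps x != 0 -> psum eps x \in t.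
Proof.
move=> yy; exists [seq z <- [seq psum eps m | m <- iota y.+1 (y' - y)] | z != 0].
  by rewrite /nz_sums -filter_cat -map_cat -[y.+1]add1n -iotaD subnKC.
move=> x xy x0; rewrite mem_filter x0 map_f // mem_iota; lia.
Qed.

Lemma nz_sums_neq0 eps y : (0 < y)%N -> nz_sums eps y != [::].
Proof.
case: y => // y _; rewrite /nz_sums /= psum1 // oner_eq0 //.
Qed.

Lemma nz_sums_all eps y : all (fun x => x != 0) (nz_sums eps y).
Proof. exact: filter_all. Qed.

Lemma nchanges_le eps y y' : (y <= y')%N -> (nchanges eps y <= nchanges eps y')%N.
Proof. by move=> /(nz_sums_cat eps)[t h _]; rewrite /nchanges h changes_cat_ge. Qed.

Lemma nchanges_lt eps y y' x : (0 < y)%N -> (y < x <= y')%N ->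
  last 0 (nz_sums eps y) * psum eps x < 0 -> (nchanges eps y < nchanges eps y')%N.
Proof.
move=> y0 xy zb; have yy : (y <= y')%N by lia.
have [t h ht] := nz_sums_cat eps yy.
rewrite /nchanges h; apply: (changes_cat_gt (b := psum eps x)) => //.
- exact: nz_sums_neq0.
- by rewrite -h nz_sums_all.
by apply: ht => //; apply: contraTneq zb => ->; rewrite mulr0 ltxx.
Qed.

Variables (e : nat) (K C1 : R).
Hypotheses (e8 : (8 <= e)%N) (K1 : 1 <= K) (C1K : 128 * C1 <= K ^+ 2)
  (Ke : 128 * (4096 * K ^+ 2) <= (2 ^ e)%:R).

Let y := (2 ^ e)%N.
Let y' := (2 ^ (10 * e))%N.
Let l := primes_in y y'.

Lemma agree_past eps eps' : agree_off l eps eps' ->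
  forall p, prime p -> (p <= y)%N -> eps' p = eps p.
Proof. by move=> h p pp py; apply: h; rewrite mem_primes_in pp ltnNge py. Qed.

Lemma past_le_future : (y <= y')%N.
Proof. by rewrite leq_exp2l // leq_pmull. Qed.

(* The mean of [1_{M(x)^2 > K^2 v(x)}] over [x] with weight [v(x) / (x (x + 1))]
   is small, since the energy up to [y'] is at most [C1] times that up to [y]. *)
Lemma good_point eps :
  avg (R := R) l (fun e' => (C1 * energy eps y < energy e' y')%R%:R) eps < 4^-1 ->
  exists x, [/\ (y < x <= y')%N, 0 < block_var e eps x,
    (forall p, p \in block e x ->
       4096 * K ^+ 2 * psum eps (x %/ p) ^+ 2 <= block_var e eps x) &
    avg (R := R) l (fun e' => (K ^+ 2 * block_var e eps x < psum e' x ^+ 2)%R%:R) eps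
      <= 3 / 8].
Proof.
move=> hE.
have K0 : 0 < K ^+ 2 by rewrite exprn_gt0 // (lt_le_trans _ K1).
have L0 : 0 < 4096 * K ^+ 2 by apply: mulr_gt0; [rewrite ltr0n|].
have := Ke; move: (4096 * K ^+ 2) L0 => L L0 Ke'.
pose v := block_var e eps.
have v0 x : 0 <= v x by exact: block_var_ge0.
pose w x : R := v x / (x * x.+1)%:R.
have w0 x : 0 <= w x by rewrite divr_ge0.
(* Here [L] is [4096 * K ^+ 2]. Every coefficient is at most [y] in absolute value, so a good [x]
   meets the smallness condition of the tail bound. *)
pose good x := L * (y ^ 2)%:R <= v x.
pose A x := avg (R := R) l (fun e' => (K ^+ 2 * v x < psum e' x ^+ 2)%R%:R) eps.
suff [x xy' [gx Ax]] : exists2 x, (1 <= x < y'.+1)%N & good x /\ A x <= 3 / 8.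
  have vx : 0 < v x.
    by apply: lt_le_trans gx; rewrite mulr_gt0 // ltr0n !expn_gt0.
  exists x; split => //.
    case/andP: xy' => _ xy'; apply/andP; split; last by rewrite -ltnS.
    by apply: leq_ltn_trans (block_var_gt0 vx); rewrite leq_exp2l // leq_pmull.
  move=> p /mem_block[_ _ _ xp]; apply: le_trans gx.
  by rewrite ler_pM2l // sqr_psum_le.
apply: contrapT => hno.
have hA x : (1 <= x < y'.+1)%N -> good x -> 3 / 8 <= A x.
  move=> xy gx; rewrite leNgt; apply/negP => hlt; apply: hno.
  by exists x => //; split => //; exact: ltW.
pose D := energy eps y; pose I := \sum_(1 <= x < y'.+1) w x.
have D2 : 2^-1 <= D by apply: energy_ge => //; rewrite expn_gt0.
have DI : D / 8 <= I by exact: block_mass.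
(* Only x > 2^(3e) = y^3 carry weight, so the bad points weigh at most L y^2 / y^3 = L / y <= 1/128.
   This is at most I / 8, because I >= D / 8 >= 1/16. *)
have bad : \sum_(1 <= x < y'.+1 | ~~ good x) w x <= I / 8.
  apply: le_trans (_ : L * (y ^ 2)%:R * (2 ^ (3 * e))%:R^-1 <= _).
    have P1y : (2 ^ (3 * e) <= y'.+1)%N by rewrite leqW // leq_exp2l // leq_mul2r orbT.
    apply: le_trans (_ : \sum_(2 ^ (3 * e) <= x < y'.+1)
      L * (y ^ 2)%:R * (x * x.+1)%:R^-1 <= _).
      rewrite [leLHS](@big_cat_nat _ _ _ (2 ^ (3 * e))) ?expn_gt0 //=.
      rewrite [X in X + _]big_nat_cond [X in X + _]big1 ?add0r; last first.
        move=> x /andP[/andP[_ x2] _]; apply/eqP; rewrite /w.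
        have [|] := ltP 0 (v x); first by move=> /block_var_gt0; rewrite ltnNge (ltnW x2).
        by move=> h; rewrite (_ : v x = 0) ?mul0r //; apply/eqP; rewrite eq_le h v0.
      rewrite big_mkcond /=; apply: ler_sum_nat => x _; case: ifP => [|_].
        by rewrite /good -ltNge => /ltW h; rewrite ler_wpM2r ?invr_ge0.
      by rewrite mulr_ge0 ?invr_ge0 // mulr_ge0 // ltW.
    rewrite -mulr_sumr sum_inv_telescope ?expn_gt0 // ler_pM2l; last first.
      by rewrite mulr_gt0 // ltr0n !expn_gt0.
    by rewrite gerBl invr_ge0.
  have yR : (0 < y%:R :> R) by rewrite ltr0n expn_gt0.
  have -> : (2 ^ (3 * e))%:R = (y%:R ^+ 3 : R) by rewrite -natrX -expnM mulnC.
  rewrite natrX (_ : _ * _ / _ = L / y%:R); last by field; rewrite gt_eqF.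
  apply: le_trans (_ : 128^-1 <= _); last by lra.
  by rewrite ler_pdivrMr // mulrC ler_pdivlMr // mulrC.
have goodI : 7 / 8 * I <= \sum_(1 <= x < y'.+1 | good x) w x.
  have : I = \sum_(1 <= x < y'.+1 | good x) w x + \sum_(1 <= x < y'.+1 | ~~ good x) w x.
    by rewrite /I (bigID good).
  lra.
(* If no point qualified, the mean of [Z] would be at least (3/8)(7/8) I = 21 I / 64. But [Z] is at
   most [I] always and at most I / 16 unless the energy jumps, so its mean is at most I / 16 + I / 4
   = 20 I / 64. *)
pose Z e' := \sum_(1 <= x < y'.+1 | good x) w x * (K ^+ 2 * v x < psum e' x ^+ 2)%R%:R.
have EZ : 3 / 8 * (7 / 8 * I) <= avg l Z eps.
  rewrite avg_sum; apply: le_trans (_ : 3 / 8 * \sum_(1 <= x < y'.+1 | good x) w x <= _).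
    by rewrite ler_wpM2l //; lra.
  rewrite mulr_sumr big_nat_cond [leRHS]big_nat_cond; apply: ler_sum => x /andP[xy gx].
  by rewrite avgZ mulrC ler_wpM2l // hA.
have ZI e' : Z e' <= I.
  rewrite /Z /I big_mkcond /=; apply: ler_sum => x _; case: ifP => // _.
  by rewrite ler_piMr // lern1 leq_b1.
have ZE e' : Z e' <= energy e' y' / K ^+ 2.
  rewrite /Z /energy mulr_suml big_mkcond /=; apply: ler_sum => x _.
  have nn : 0 <= psum e' x ^+ 2 / (x * x.+1)%:R / K ^+ 2.
    by rewrite !divr_ge0 ?sqr_ge0.
  case: ifP => // _; case: ltP => [h|_]; last by rewrite mulr0.
  rewrite mulr1 /w mulrAC ler_wpM2r ?invr_ge0 // ler_pdivlMr // mulrC.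
  exact: ltW.
have : avg l Z eps <= I / 16 + I * 4^-1.
  apply: le_trans (_ : avg (R := R) l (fun e' =>
    I / 16 + I * (C1 * D < energy e' y')%R%:R) eps <= _).
    apply: avg_le => e' _; case: ltP => [_|h].
      by rewrite mulr1; have := ZI e'; lra.
    rewrite mulr0 addr0; apply: le_trans (ZE e') _.
    rewrite ler_pdivrMr // (le_trans h) // (@le_trans _ _ (K ^+ 2 / 128 * D)) //.
      have D0 : 0 <= D by apply: le_trans D2; rewrite invr_ge0.
      by rewrite ler_wpM2r // ler_pdivlMr // mulrC; exact: C1K.
    have : K ^+ 2 * (D / 128) <= K ^+ 2 * (I / 16).
      by rewrite (ler_pM2l K0); lra.
    lra.
  rewrite avgD avg_cst avgZ lerD2l ler_wpM2l //; last exact: ltW.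
  lra.
lra.
Qed.

(** Half of the probability [rad_tail K / 4] of a new sign change, since such a change at least
    halves the weight 2^(-N). *)
Definition step_gain : R := rad_tail K / 8.

(** One step of a supermartingale. Either the energy jumps with probability at least 1/4, and the
    penalty [1 - 4 * step_gain] yields the gain, or [good_point] supplies an [x] where a sign change
    is likely enough. *)
Lemma step eps :
  avg l (fun e' => 2^-1 ^+ nchanges e' y' *
    (if C1 * energy eps y < energy e' y' then 1 - 4 * step_gain else 1)) eps <=
  (1 - step_gain) * 2^-1 ^+ nchanges eps y.
Proof.
have c0 : 0 < step_gain by rewrite divr_gt0 ?rad_tail_gt0.
have c1 : step_gain <= 32^-1 by have := rad_tail_le K; rewrite /step_gain; lra.
have N0 n : 0 < 2^-1 ^+ n :> R by rewrite exprn_gt0.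
have Nle n m : (n <= m)%N -> 2^-1 ^+ m <= 2^-1 ^+ n :> R.
  by move=> nm; rewrite ler_wiXn2l //; lra.
have past e' : agree_off l eps e' -> nz_sums e' y = nz_sums eps y.
  by move=> /agree_past h; apply: nz_sums_dep.
have pastN e' : agree_off l eps e' -> nchanges e' y = nchanges eps y.
  by move=> /past; rewrite /nchanges => ->.
have [hE|hE] := leP 4^-1
  (avg (R := R) l (fun e' => (C1 * energy eps y < energy e' y')%R%:R) eps).
  apply: le_trans (_ : avg (R := R) l (fun e' => 2^-1 ^+ nchanges eps y +
      (- (2^-1 ^+ nchanges eps y * (4 * step_gain))) *
      (C1 * energy eps y < energy e' y')%R%:R) eps <= _).
    apply: avg_le => e' he.
    have h : 2^-1 ^+ nchanges e' y' <= 2^-1 ^+ nchanges eps y :> R.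
      by rewrite Nle // -(pastN _ he) nchanges_le // past_le_future.
    case: ifP => _; last by rewrite mulr1 mulr0 addr0.
    have : 2^-1 ^+ nchanges e' y' * (1 - 4 * step_gain) <=
        2^-1 ^+ nchanges eps y * (1 - 4 * step_gain) by rewrite ler_wpM2r //; lra.
    rewrite mulr1; lra.
  rewrite avgD avg_cst avgZ.
  have := N0 (nchanges eps y); set a := _ ^+ _; set b := avg _ _ _ in hE * => a0.
  have : a * step_gain * (4 * b) >= a * step_gain * 1.
    by rewrite ler_wpM2l //; [rewrite mulr_ge0 ?ltW | lra].
  lra.
have [x [xy vx small hx]] := good_point hE.
pose b := block e x; pose a p := psum eps (x %/ p).
pose Psi e' := psum e' x - rad_sum b a e'.
have bl : {subset b <= l} by exact: block_sub.
have bE e' : agree_off l eps e' -> {in b, forall p, psum e' (x %/ p) = a p}.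
  move=> he p /mem_block[_ _ _ px]; apply: psum_dep => q qq qx.
  by apply: (agree_past he) => //; exact: leq_trans px.
have split e' : psum e' x =
    \sum_(1 <= n < x.+1 | all (fun p => ~~ (p %| n)%N) b) hval R chi e' n +
    rad_sum b (fun p => psum e' (x %/ p)) e'.
  apply: (@psum_split R chi chiP e' x y b); first exact: block_uniq.
  move=> p /mem_block[-> p1 _ ->]; rewrite andbT /=.
  by apply: leq_ltn_trans p1; rewrite leq_exp2l // leq_pmull.
have [neg pos] : rad_tail K / 4 <= avg (R := R) l (fun e => (psum e x < 0)%R%:R) eps /\
  rad_tail K / 4 <= avg (R := R) l (fun e => (0 < psum e x)%R%:R) eps.
  apply: (@sign_flip R l b a K (fun e' => psum e' x)
    (fun e' => \sum_(1 <= n < x.+1 | all (fun p => ~~ (p %| n)%N) b) hval R chi e' n)) => //.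
  - exact: block_uniq.
  - move=> e' he; rewrite split; congr (_ + _).
    by apply: eq_big_seq => p pb; rewrite bE.
  move=> e1 e2 he; apply: eq_bigr => n /allP nb; apply: hval_dep => p pp pn.
  by apply: he; apply/negP => /nb; rewrite pn.
have {neg pos} hz : rad_tail K / 4 <=
    avg (R := R) l (fun e => (last 0 (nz_sums eps y) * psum e x < 0)%R%:R) eps.
  set z := last 0 _.
  have : z != 0.
    have := nz_sums_neq0 eps (_ : 0 < y)%N; rewrite expn_gt0 => /(_ isT).
    rewrite /z; have := nz_sums_all eps y; case: (nz_sums eps y) => // c s /allP h _.
    by apply: h; rewrite /= mem_last.
  rewrite neq_lt => /orP[z0|z0].
    by under eq_avg do rewrite nmulr_rlt0 //.
  by under eq_avg do rewrite pmulr_rlt0 //.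
apply: le_trans (_ : avg (R := R) l (fun e' => 2^-1 ^+ nchanges eps y +
    (- (2^-1 ^+ nchanges eps y * 2^-1)) *
      (last 0 (nz_sums eps y) * psum e' x < 0)%R%:R) eps <= _).
  apply: avg_le => e' he.
  apply: le_trans (_ : 2^-1 ^+ nchanges e' y' <= _).
    by rewrite (ler_piMr (ltW (N0 _))) //; case: ifP => // _; lra.
  case: (boolP (_ < 0)) => h.
    have : 2^-1 ^+ nchanges e' y' <= 2^-1 ^+ (nchanges eps y).+1 :> R.
      by rewrite Nle // -(pastN _ he) (nchanges_lt (x := x)) ?expn_gt0 // (past _ he).
    rewrite exprS mulr1; lra.
  by rewrite mulr0 addr0 Nle // -(pastN _ he) nchanges_le // past_le_future.
rewrite avgD avg_cst avgZ.
have := N0 (nchanges eps y); move: hz; rewrite /step_gain.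
set m := _ ^+ _; set B := avg _ _ _; set r := rad_tail K => hz m0.
have : m * (r / 4) <= m * B by rewrite ler_pM2l.
lra.
Qed.

End Step.

(** * Second moments *)

Section SquarePairs.
Local Open Scope nat_scope.

Lemma even_logn_square n : 0 < n -> (forall p, ~~ odd (logn p n)) ->
  exists2 s, 0 < s & n = s ^ 2.
Proof.
move=> n0 h; pose s := \prod_(p <- primes n) p ^ (logn p n)./2.
have ns : n = s ^ 2.
  rewrite {1}(prod_prime_decomp n0) prime_decompE big_map /= expnS expn1 -big_split /=.
  by apply: eq_bigr => p _; rewrite -expnD addnn even_halfK ?h.
by exists s => //; rewrite lt0n; apply: contraTneq n0 => s0; rewrite ns s0.
Qed.

(** Take [d = gcdn a b]. The cofactors are coprime, so each prime divides at most one of them, there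
    with even exponent; both are squares. *)
Lemma even_logn_mul a b : 0 < a -> 0 < b -> (forall p, ~~ odd (logn p (a * b))) ->
  exists d s t, [/\ 0 < d, 0 < s, 0 < t, a = d * s ^ 2 & b = d * t ^ 2].
Proof.
move=> a0 b0 h; pose g := gcdn a b.
have g0 : 0 < g by rewrite gcdn_gt0 a0.
have [a' ea] : exists a', a = g * a' by exists (a %/ g); rewrite mulnC divnK ?dvdn_gcdl.
have [b' eb] : exists b', b = g * b' by exists (b %/ g); rewrite mulnC divnK ?dvdn_gcdr.
have a'0 : 0 < a' by move: a0; rewrite ea muln_gt0 => /andP[].
have b'0 : 0 < b' by move: b0; rewrite eb muln_gt0 => /andP[].
have cop : coprime a' b'.
  by rewrite /coprime -(eqn_pmul2l g0) muln1 muln_gcdr -ea -eb.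
have ev p : ~~ odd (logn p a' + logn p b').
  have := h p; rewrite ea eb mulnACA !lognM ?muln_gt0 ?g0 ?a'0 //.
  by rewrite !oddD addbb.
have z p : logn p a' = 0 \/ logn p b' = 0.
  have [->|] := posnP (logn p a'); first by left.
  rewrite logn_gt0 mem_primes => /and3P[pp _ pa]; right.
  apply/eqP; rewrite lognE; case: and3P => // -[_ _ pb].
  have : p %| gcdn a' b' by rewrite dvdn_gcd pa.
  by rewrite (eqP cop) dvdn1 => /eqP p1; rewrite p1 in pp.
have [s s0 es] : exists2 s, 0 < s & a' = s ^ 2.
  by apply: even_logn_square => // p; have := ev p; case: (z p) => ->; rewrite ?addn0.
have [t t0 et] : exists2 t, 0 < t & b' = t ^ 2.
  by apply: even_logn_square => // p; have := ev p; case: (z p) => ->; rewrite ?addn0.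
by exists g, s, t; rewrite -es -et.
Qed.

(** For positive [d] this is floor(sqrt(x / d)). *)
Definition sqcount x d := \sum_(1 <= s < x.+1) (d * s ^ 2 <= x).

Lemma sqcount_le x d : d * sqcount x d ^ 2 <= x.
Proof.
set c := sqcount x d; rewrite leqNgt; apply/negP => h.
have c0 : 0 < c by case: (c) h => //; rewrite muln0.
have : c <= \sum_(1 <= s < x.+1) (s <= c.-1).
  apply: leq_sum => s _; case: (leqP (d * s ^ 2) x) => // sx.
  case: (leqP s c.-1) => // cs.
  have : d * c ^ 2 <= d * s ^ 2 by rewrite leq_mul2l leq_exp2r //; lia.
  lia.
rewrite sum_nat_leq_minn; lia.
Qed.

Lemma sum_eqn_le x n : \sum_(1 <= a < x.+1) (a == n) <= (n <= x).
Proof.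
elim: x => [|x IH]; first by rewrite big_geq.
by rewrite big_nat_recr //=; case: eqP => [e|e]; lia.
Qed.

(** Pairs whose product is a perfect square, tested by the parity of its valuations: these are the
    pairs whose signs do not average out. *)
Definition square_pairs x :=
  \sum_(1 <= a < x.+1) \sum_(1 <= b < x.+1)
    all (fun p => ~~ odd (logn p (a * b))) (primes (a * b)).

(** Every such pair has the form (d s^2, d t^2). Since [d] need not be squarefree, pairs may be
    counted several times, which is harmless for an upper bound. *)
Lemma square_pairs_le x : square_pairs x <= \sum_(1 <= d < x.+1) sqcount x d ^ 2.
Proof.
apply: leq_trans (_ : \sum_(1 <= a < x.+1) \sum_(1 <= b < x.+1)
  \sum_(1 <= d < x.+1) \sum_(1 <= s < x.+1) \sum_(1 <= t < x.+1)
    (a == d * s ^ 2) * (b == d * t ^ 2) <= _).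
  rewrite /square_pairs big_nat_cond [leqRHS]big_nat_cond;
  apply: leq_sum => a /andP[/andP[a0 ax] _].
  rewrite big_nat_cond [leqRHS]big_nat_cond;
  apply: leq_sum => b /andP[/andP[b0 bx] _].
  case: (boolP (all _ _)) => // /allP h.
  have [||p|d [s [t [d0 s0 t0 ea eb]]]] := @even_logn_mul a b => //.
    have [->//|] := posnP (logn p (a * b)).
    by rewrite logn_gt0 => /h.
  have le1 u n : 0 < d -> 0 < u -> n = d * u ^ 2 -> n < x.+1 ->
      (0 < d < x.+1) && (0 < u < x.+1).
    by move=> ? ? -> ?; have : u <= u ^ 2 by [rewrite -{1}(expn1 u) leq_pexp2l]; nia.
  have /andP[dx sx] := le1 s a d0 s0 ea ax.
  have /andP[_ tx] := le1 t b d0 t0 eb bx.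
  rewrite (big_rem d) ?mem_index_iota //= (big_rem s) ?mem_index_iota //=.
  rewrite (big_rem t) ?mem_index_iota //= -ea -eb !eqxx; lia.
rewrite (eq_bigr (fun a => \sum_(1 <= d < x.+1) \sum_(1 <= b < x.+1)
    \sum_(1 <= s < x.+1) \sum_(1 <= t < x.+1) (a == d * s ^ 2) * (b == d * t ^ 2)));
  last by move=> a _; rewrite exchange_big.
rewrite exchange_big /=; apply: leq_sum => d _.
rewrite (_ : \sum_(1 <= a < x.+1) _ =
   (\sum_(1 <= s < x.+1) \sum_(1 <= a < x.+1) (a == d * s ^ 2)) *
   (\sum_(1 <= t < x.+1) \sum_(1 <= b < x.+1) (b == d * t ^ 2))).
  by rewrite expnS expn1; apply: leq_mul; apply: leq_sum => s _; exact: sum_eqn_le.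
rewrite [X in X * _]exchange_big [X in _ * X]exchange_big big_distrl /=.
apply: eq_bigr => a _.
rewrite big_distrr /=; apply: eq_bigr => b _.
rewrite big_distrl /=; apply: eq_bigr => s _.
by rewrite big_distrr.
Qed.

End SquarePairs.

Section SecondMoment.
Variables (R : realType) (chi : pred nat).
Implicit Types (eps : signs).

Lemma mulsgn_flip eps p n : (0 < n)%N -> (p <= n)%N ->
  mulsgn R (upd eps p true) n = (-1) ^+ logn p n * mulsgn R (upd eps p false) n.
Proof.
move=> n0 pn; rewrite /mulsgn -exprD; congr (_ ^+ _).
rewrite /odd_primes big_mkcond [in RHS]big_mkcond /= (bigD1_seq p) ?mem_index_iota ?iota_uniq //=.
rewrite [in RHS](bigD1_seq p) ?mem_index_iota ?iota_uniq //= /upd eqxx add0n.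
by congr (_ + _)%N; apply: eq_bigr => q /negPf ->.
Qed.

(** If a prime divides [n] to an odd power, averaging over its sign alone already gives 0. *)
Lemma avg_mulsgn eps N n : (0 < n)%N -> (forall p, prime p -> (p %| n)%N -> (p <= N)%N) ->
  avg (primes_in 0 N) (fun e => mulsgn R e n) eps
    <= (all (fun p => ~~ odd (logn p n)) (primes n))%:R.
Proof.
move=> n0 hN; case: (boolP (all _ _)) => [_|/allPn[p pn]].
  rewrite -(avg_cst (primes_in 0 N) 1 eps); apply: avg_le => e _.
  by rewrite /mulsgn -signr_odd; case: odd; rewrite ?expr0 ?expr1 //; lra.
rewrite negbK => op; have := pn; rewrite mem_primes => /and3P[pp _ pdn].
rewrite -(@avg_avg1 _ p); last by rewrite mem_primes_in pp prime_gt0 ?hN.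
rewrite (@avg_const _ _ _ 0) // => e _.
have h : mulsgn R (upd e p true) n = - mulsgn R (upd e p false) n.
  rewrite (mulsgn_flip e n0 (dvdn_leq n0 pdn)).
  by rewrite (_ : (-1) ^+ logn p n = -1) ?mulN1r // -signr_odd op expr1.
by rewrite /avg1 h subrr mul0r.
Qed.

(** Expanding the square leaves only pairs with square product, at most the sum of x / d over d <=
    x; the harmonic bound finishes. *)
Lemma avg_sqr_psum eps N x e : (x <= N)%N -> (x <= 2 ^ e)%N ->
  avg (primes_in 0 N) (fun e => psum R chi e x ^+ 2) eps <= x%:R * (1 + e%:R).
Proof.
move=> xN xe; apply: le_trans (_ : (square_pairs x)%:R <= _).
  have E e' : psum R chi e' x ^+ 2 = \sum_(1 <= a < x.+1) \sum_(1 <= b < x.+1)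
      (chi a && chi b)%:R * (mulsgn R e' a * mulsgn R e' b).
    rewrite expr2 /psum /partial_sum mulr_suml; apply: eq_bigr => a _.
    by rewrite mulr_sumr; apply: eq_bigr => b _; rewrite /hval mulrACA -natrM mulnb.
  rewrite (eq_avg (fun e' _ => E e')) avg_sum /square_pairs natr_sum.
  apply: ler_sum_nat => a /andP[a0 ax]; rewrite avg_sum natr_sum.
  apply: ler_sum_nat => b /andP[b0 bx]; rewrite avgZ.
  case: (_ && _); last by rewrite mul0r.
  rewrite mul1r; have ab0 : (0 < a * b)%N by rewrite muln_gt0 a0.
  have hN p : prime p -> (p %| a * b)%N -> (p <= N)%N.
    by move=> pp; rewrite Euclid_dvdM // => /orP[] /dvdn_leq; lia.
  apply: le_trans (avg_mulsgn eps ab0 hN).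
  by apply: avg_le => e' _; rewrite mulsgnM.
apply: le_trans (_ : \sum_(1 <= d < x.+1) x%:R * d%:R^-1 <= _).
  apply: le_trans (_ : (\sum_(1 <= d < x.+1) sqcount x d ^ 2)%:R <= _).
    by rewrite ler_nat square_pairs_le.
  rewrite natr_sum; apply: ler_sum_nat => d /andP[d0 _].
  by rewrite ler_pdivlMr ?ltr0n // -natrM ler_nat mulnC sqcount_le.
rewrite -mulr_sumr ler_wpM2l //; apply: le_trans (harmonic_pow2 R e).
rewrite [leRHS](@big_cat_nat _ _ _ x.+1) //= lerDl.
by apply: sumr_ge0 => d _; rewrite invr_ge0.
Qed.

Lemma avg_energy eps e :
  avg (primes_in 0 (2 ^ e)) (fun e' => energy R chi e' (2 ^ e)) eps <= (1 + e%:R) ^+ 2.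
Proof.
rewrite avg_sum; apply: le_trans (_ : \sum_(1 <= x < (2 ^ e).+1) (1 + e%:R) * x%:R^-1 <= _).
  apply: ler_sum_nat => x /andP[x0 xe].
  rewrite (eq_avg (Psi := fun e' => (x * x.+1)%:R^-1 * psum R chi e' x ^+ 2)); last first.
    by move=> e' _; rewrite mulrC.
  rewrite avgZ mulrC ler_pdivrMr ?ltr0n ?muln_gt0 ?x0 //.
  apply: le_trans (@avg_sqr_psum eps (2 ^ e) x e _ _) _; rewrite -1?ltnS //.
  have xR : (0 < x%:R :> R) by rewrite ltr0n.
  rewrite natrM mulrA mulfVK ?gt_eqF //.
  by rewrite mulrC ler_wpM2l ?addr_ge0 // ler_nat.
by rewrite -mulr_sumr expr2 ler_wpM2l ?addr_ge0 // harmonic_pow2.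
Qed.

End SecondMoment.

(** * Iteration over the scales *)

Section Iteration.
Variables (R : realType) (chi : pred nat).
Hypothesis chiP : support_ok chi.
Implicit Types (eps : signs).
Local Notation energy := (energy R chi).
Local Notation nchanges := (nchanges R chi).

Definition scale_exp e0 k : nat := (10 ^ k * e0)%N.
Definition scale e0 k : nat := (2 ^ scale_exp e0 k)%N.

Lemma scale_mono e0 j k : (j <= k)%N -> (scale e0 j <= scale e0 k)%N.
Proof. by move=> jk; rewrite leq_exp2l // leq_mul // leq_exp2l. Qed.

Definition fails C1 e0 eps k : nat :=
  (\sum_(j < k) (C1 * energy eps (scale e0 j) < energy eps (scale e0 j.+1))%R)%N.

Lemma fails_dep C1 e0 eps eps' k :
  (forall p, prime p -> (p <= scale e0 k)%N -> eps' p = eps p) ->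
  fails C1 e0 eps' k = fails C1 e0 eps k.
Proof.
move=> h; apply: eq_bigr => j _.
have dep i : (i <= k)%N -> energy eps' (scale e0 i) = energy eps (scale e0 i).
  move=> ik; apply: energy_dep => p pp pi; apply: h => //.
  exact: leq_trans (scale_mono _ ik).
by rewrite !dep // ltnW.
Qed.

(** The energy starts at 1/2 or more, never decreases, and gains a factor [C1] at each failure. *)
Lemma fails_energy C1 e0 eps k : 1 <= C1 ->
  C1 ^+ fails C1 e0 eps k / 2 <= energy eps (scale e0 k).
Proof.
move=> C11; elim: k => [|k IH].
  rewrite /fails big_ord0 expr0 mul1r; apply: energy_ge => //.
  by rewrite expn_gt0.
rewrite /fails big_ord_recr /= -/(fails _ _ _ _); case: ltP => h.
  rewrite addn1 exprS -mulrA; apply: le_trans (ltW h).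
  by rewrite ler_wpM2l // (le_trans _ C11).
by rewrite addn0 (le_trans IH) // energy_mono // scale_mono.
Qed.

Lemma iterate (K C1 : R) e0 k eps :
  (8 <= e0)%N -> 1 <= K -> 128 * C1 <= K ^+ 2 ->
  128 * (4096 * K ^+ 2) <= (2 ^ e0)%:R ->
  avg (primes_in 0 (scale e0 k)) (fun e => 2^-1 ^+ nchanges e (scale e0 k) *
     (1 - 4 * step_gain K) ^+ fails C1 e0 e k) eps <= (1 - step_gain K) ^+ k.
Proof.
move=> e8 K1 C1K Ke.
have g0 : 0 < step_gain K by rewrite divr_gt0 ?rad_tail_gt0.
have g1 : step_gain K <= 32^-1 by have := rad_tail_le K; rewrite /step_gain; lra.
have q0 : 0 <= 1 - 4 * step_gain K by lra.
have q1 : 1 - 4 * step_gain K <= 1 by lra.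
elim: k eps => [|k IH] eps.
  rewrite -[leRHS](avg_cst (primes_in 0 (scale e0 0)) 1 eps); apply: avg_le => e _.
  rewrite /fails big_ord0 !expr0 mulr1 exprn_ile1 //; lra.
have sk := scale_mono e0 (leqnSn k).
rewrite (primes_in_cat (leq0n _) sk) avg_cat exprS.
apply: le_trans (_ : avg (primes_in 0 (scale e0 k)) (fun e => (1 - step_gain K) *
  (2^-1 ^+ nchanges e (scale e0 k) * (1 - 4 * step_gain K) ^+ fails C1 e0 e k)) eps <= _);
  last by rewrite avgZ ler_wpM2l //; lra.
apply: avg_le => e _.
have ek8 : (8 <= scale_exp e0 k)%N.
  by apply: leq_trans e8 _; rewrite leq_pmull // expn_gt0.
have Kek : 128 * (4096 * K ^+ 2) <= (2 ^ scale_exp e0 k)%:R.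
  by apply: le_trans Ke _; rewrite ler_nat leq_exp2l // leq_pmull // expn_gt0.
have := step chiP ek8 K1 C1K Kek e.
have -> : (2 ^ (10 * scale_exp e0 k) = scale e0 k.+1)%N.
  by rewrite /scale /scale_exp expnS mulnA.
rewrite -/(scale e0 k) => h.
rewrite [leRHS]mulrA [leRHS]mulrC.
apply: le_trans (ler_wpM2l (exprn_ge0 (fails C1 e0 e k) q0) h); rewrite -avgZ.
apply: avg_le => e' he.
have past : forall p, prime p -> (p <= scale e0 k)%N -> e' p = e p.
  by move=> p pp pk; apply: he; rewrite mem_primes_in pp ltnNge pk.
rewrite [leRHS]mulrCA ler_wpM2l ?exprn_ge0 //.
rewrite {1}/fails big_ord_recr /= -/(fails _ _ _ _) (fails_dep _ past).
rewrite (energy_dep R chi past) exprD ler_wpM2l ?exprn_ge0 //.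
by case: ltP; rewrite ?expr1 ?expr0.
Qed.

End Iteration.

(** * Exponential rarity of few sign changes *)

Section Tail.
Variable R : realType.

(** It trades at most k / 8 failure factors 1 - 4x for k factors 1 - 3x/4. The power is reached by
    three squarings, with second-order terms absorbed by x <= 1/32. *)
Lemma exp8_le (x : R) : 0 <= x -> x <= 32^-1 -> (1 - 3 / 4 * x) ^+ 8 <= 1 - 4 * x.
Proof.
move=> x0 x1; have sq (u v : R) : 0 <= u <= v -> u ^+ 2 <= v ^+ 2.
  by move=> /andP[u0 uv]; rewrite ler_pXn2r ?nnegrE // (le_trans u0).
have xx : x ^+ 2 <= x / 32 by rewrite expr2 ler_wpM2l.
have h1 : (1 - 3 / 4 * x) ^+ 2 <= 1 - 14 / 10 * x by lra.
have h2 : ((1 - 3 / 4 * x) ^+ 2) ^+ 2 <= 1 - 26 / 10 * x.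
  by apply: le_trans (sq _ _ _) _; [rewrite sqr_ge0; exact: h1|lra].
rewrite (exprM _ 4 2) (exprM _ 2 2).
by apply: le_trans (sq _ _ _) _; [rewrite sqr_ge0; exact: h2|lra].
Qed.

Lemma exists_expn_le (a c : R) : 0 <= a < 1 -> 0 < c -> exists m : nat, a ^+ m <= c.
Proof.
move=> /andP[a0 a1] c0.
have := @cvg_expr R a; rewrite ger0_norm // => /(_ a1) /cvgrPdist_le /(_ c c0)[m _ /(_ m)].
rewrite /= => /(_ (leqnn m)); rewrite sub0r normrN ger0_norm ?exprn_ge0 // => h.
by exists m.
Qed.

(* Where the energy is at most [200 ^ k], at most [k / 8] of the steps multiply
   it by more than [200 ^ 8]. *)
Lemma few_changes_tail : exists (m e0 : nat) (r C : R),
  [/\ (0 < m)%N, (0 < e0)%N, 0 <= r < 1, 0 <= C &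
   forall chi, support_ok chi -> forall k eps,
   avg (R := R) (primes_in 0 (scale e0 k))
     (fun e => (m * nchanges R chi e (scale e0 k) <= k)%N%:R) eps <= C * r ^+ k].
Proof.
(* The mean energy grows at most like 100^k, so 200^k is exceeded with probability O(2^(-k)). The
   choice of [K] gives [K ^+ 2 = 144 * C1]. *)
pose C1 : R := 200 ^+ 8; pose K : R := 12 * 200 ^+ 4.
have t1 n : 1 <= 200 ^+ n :> R by apply: exprn_ege1; lra.
have K1 : 1 <= K by have := t1 4%N; rewrite /K; lra.
have C1K : 128 * C1 <= K ^+ 2.
  by rewrite /K exprMn -exprM /C1 ler_wpM2r ?(le_trans _ (t1 8%N)) //; lra.
have [e0 e08 Ke] : exists2 e0, (8 <= e0)%N & 128 * (4096 * K ^+ 2) <= (2 ^ e0)%:R.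
  have : 0 < 128 * (4096 * K ^+ 2).
    by apply: mulr_gt0; [|apply: mulr_gt0; [|apply: exprn_gt0; lra]]; rewrite ltr0n.
  move: (128 * (4096 * K ^+ 2)) => X X0.
  have [||n hn] := @exists_expn_le (2^-1) X^-1; [lra|by rewrite invr_gt0|].
  exists (n + 8)%N; first exact: leq_addl.
  apply: (@le_trans _ _ (2 ^ n)%:R); last by rewrite ler_nat leq_exp2l // leq_addr.
  by rewrite natrX -lef_pV2 ?posrE ?exprn_gt0 // -exprVn.
pose g := step_gain K.
have g0 : 0 < g by rewrite divr_gt0 ?rad_tail_gt0.
have g1 : g <= 32^-1 by have := rad_tail_le K; rewrite /g /step_gain; lra.
have a01 : 0 <= 1 - g / 8 < 1 by lra.
have /andP[a0 /ltW a1] := a01.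
have /andP[b0 b1] : 0 <= 1 - 3 / 4 * g <= 1 by lra.
have q0 : 0 <= 1 - 4 * g by lra.
have o2 : 0 <= 2^-1 :> R by rewrite invr_ge0.
have [m hm] : exists m : nat, (1 - g / 8) ^+ m <= 2^-1.
  by apply: exists_expn_le; rewrite // invr_gt0.
have m0 : (0 < m)%N by case: m hm => //; rewrite expr0; lra.
(* Where sign changes and failures are both few, the weight is at least [d ^+ k]: the first factor
   accounts for the changes through [m], the second for the failures. As [1 - g < d], Markov's
   inequality gives exponential decay. *)
pose d := (1 - g / 8) * (1 - 3 / 4 * g).
have d0 : 0 < d by rewrite mulr_gt0 //; lra.
have gd : 1 - g < d by rewrite /d; have := sqr_ge0 g; lra.
pose r := Num.max ((1 - g) / d) 2^-1.
have r2 : 2^-1 <= r by rewrite le_max lexx orbT.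
have r0 : 0 <= r by lra.
have r1 : r < 1 by rewrite gt_max ltr_pdivrMr // mul1r gd /=; lra.
exists m, e0, r, (1 + (1 + e0%:R) ^+ 2); split => //.
  exact: leq_trans e08.
  by rewrite r0.
move=> chi chiP k eps; set l := primes_in _ _.
pose N e := nchanges R chi e (scale e0 k).
pose E e := energy R chi e (scale e0 k).
(* Two Markov bounds: the second term covers energies above 200^k, the first all other outcomes with
   few changes. *)
apply: le_trans (_ : avg l (fun e => d ^- k *
   (2^-1 ^+ N e * (1 - 4 * g) ^+ fails chi C1 e0 e k) + 200 ^- k * E e) eps <= _).
  apply: avg_le => e _.
  have E0 : 0 <= E e by apply: sumr_ge0 => x _; exact: energy_term_ge0.
  have p200 n : 0 < 200 ^+ n :> R by rewrite exprn_gt0 // ltr0n.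
  have t1pos : 0 <= d ^- k * (2^-1 ^+ N e * (1 - 4 * g) ^+ fails chi C1 e0 e k).
    by rewrite mulr_ge0 ?invr_ge0 ?exprn_ge0 ?(ltW d0) // mulr_ge0 // exprn_ge0.
  have t2pos : 0 <= 200 ^- k * E e.
    by rewrite mulr_ge0 // invr_ge0 ltW.
  case: (boolP (m * N e <= k)%N) => mN; last by rewrite addr_ge0.
  have [hE|hE] := leP (E e) (200 ^+ k); last first.
    apply: le_trans (_ : 200 ^- k * E e <= _); last by rewrite lerDr.
    by rewrite mulrC ler_pdivlMr // mul1r ltW.
  apply: le_trans (_ : d ^- k * (2^-1 ^+ N e * (1 - 4 * g) ^+ fails chi C1 e0 e k) <= _);
    last by rewrite lerDl.
  rewrite mulrC ler_pdivlMr ?exprn_gt0 // mul1r /d exprMn.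
  set F := fails _ _ _ _ _.
  (* Otherwise 200^(k+1) <= 200^(8F) <= 2 * 200^k. *)
  have F8 : (8 * F <= k)%N.
    rewrite leqNgt; apply/negP => kF.
    have := le_trans (fails_energy chiP e0 e k (t1 8%N)) hE.
    rewrite -/F ler_pdivrMr // -exprM => h.
    have : 200 ^+ k.+1 <= 200 ^+ k * 2 :> R.
      by apply: le_trans h; rewrite ler_eXn2l // ltr1n.
    rewrite exprS mulrC ler_pM2l // ler_nat.
    by [].
  apply: ler_pM; rewrite ?exprn_ge0 //.
    apply: le_trans (_ : (1 - g / 8) ^+ (m * N e) <= _).
      by rewrite ler_wiXn2l.
    by rewrite exprM lerXn2r // ?nnegrE ?exprn_ge0.
  apply: le_trans (_ : (1 - 3 / 4 * g) ^+ (8 * F) <= _).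
    by rewrite ler_wiXn2l.
  by rewrite exprM lerXn2r ?nnegrE ?exprn_ge0 ?exp8_le ?(ltW g0).
rewrite avgD !avgZ [leRHS]mulrDl [X in _ <= X + _]mul1r; apply: lerD.
  apply: le_trans (_ : d ^- k * (1 - g) ^+ k <= _).
    rewrite ler_wpM2l ?invr_ge0 ?exprn_ge0 ?(ltW d0) //.
    exact: iterate.
  rewrite -exprVn -exprMn lerXn2r ?nnegrE //.
    by rewrite mulr_ge0 ?invr_ge0 ?(ltW d0) //; lra.
  by rewrite /r le_max mulrC lexx.
apply: le_trans (_ : 200 ^- k * (1 + (scale_exp e0 k)%:R) ^+ 2 <= _).
  by rewrite ler_wpM2l ?invr_ge0 ?exprn_ge0 //; exact: avg_energy.
apply: le_trans (_ : 200 ^- k * (10 ^+ k * (1 + e0%:R)) ^+ 2 <= _).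
  rewrite ler_wpM2l ?invr_ge0 ?exprn_ge0 // lerXn2r ?nnegrE ?addr_ge0 ?mulr_ge0 ?exprn_ge0 //.
  rewrite mulrDr mulr1 /scale_exp natrM natrX lerD2r exprn_ege1 // ler1n //.
rewrite exprMn mulrA mulrC ler_wpM2l ?sqr_ge0 //.
rewrite exprAC -exprVn -exprMn lerXn2r ?nnegrE //; first by lra.

Qed.

End Tail.

(** * Transfer to the probability space *)

Lemma squarefreeP n : (0 < n)%N ->
  reflect (forall p, prime p -> (logn p n <= 1)%N) (squarefree n).
Proof.
move=> n0; rewrite /squarefree n0; apply: (iffP allP) => h p.
  move=> pp; have [->//|lp] := posnP (logn p n).
  have := h p; rewrite -logn_gt0 => /(_ lp).
  by rewrite pfactor_dvdn // -ltnNge ltnS.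
rewrite mem_primes => /and3P[pp _ _].
by rewrite pfactor_dvdn // -ltnNge ltnS h.
Qed.

Lemma support_squarefree : support_ok squarefree.
Proof.
split=> // p m pp m0 pm; have p0 := prime_gt0 pp.
have pm0 : (0 < p * m)%N by rewrite muln_gt0 p0.
have lm : logn p m = 0%N by apply/eqP; rewrite lognE pp m0 (negPf pm).
apply/squarefreeP/squarefreeP => // h q qq; have := h q qq.
  by rewrite lognM //; apply: leq_trans; rewrite leq_addl.
rewrite lognM // (logn_prime _ pp).
by have [->|_] := eqVneq; rewrite ?lm // add0n.
Qed.

Lemma support_all : support_ok predT.
Proof. by []. Qed.

Lemma mobius_sqr (R : realType) n : (mobius n)%:~R ^+ 2 = (squarefree n)%:R :> R.
Proof.
rewrite /mobius; case: ifP => _; last by rewrite expr0n.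
by rewrite rmorphXn /= rmorphN1 -exprM mulnC exprM sqrrN expr1n expr1n.
Qed.

Section Law.
Variables (d : measure_display) (T : measurableType d) (R : realType)
  (P : probability T R) (f : nat -> {RV P >-> R}).
Hypothesis fP : extended_rademacher f.

Definition sign_of (w : T) : signs := fun p => f p w == -1.

Lemma sign_ofE p w : (0 < p)%N -> f p w = (-1) ^+ sign_of w p.
Proof.
move=> p0; rewrite /sign_of; case: (ext_rademacher_sign fP w p0) => ->.
  by rewrite -addr_eq0 (_ : 1 + 1 = 2) ?pnatr_eq0.
by rewrite eqxx expr1.
Qed.

Lemma rademacher_mulsgn n w : (0 < n)%N -> f n w = mulsgn R (sign_of w) n.
Proof.
have [f1 fM] := ext_rademacher_mult fP w.
elim/ltn_ind: n => n IH n0; have [n1|n1] := leqP n 1.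
  by rewrite (_ : n = 1%N) ?mulsgn1 //; lia.
have pp := pdiv_prime n1; have p0 := prime_gt0 pp.
have e : n = (pdiv n * (n %/ pdiv n))%N by rewrite mulnC divnK ?pdiv_dvd.
have m0 : (0 < n %/ pdiv n)%N by rewrite divn_gt0 // dvdn_leq ?pdiv_dvd.
rewrite e fM // mulsgnM // mulsgn_prime // sign_ofE // IH //.
by rewrite ltn_Pdiv // prime_gt1.
Qed.

Definition cylinder (l : seq nat) (e : signs) : set T :=
  [set w | {in l, sign_of w =1 e}].

Lemma cylinderE l e : {in l, forall p, prime p} ->
  cylinder l e = \bigcap_(p in [set` [fset p in l]%fset]) (f p @^-1` [set (-1) ^+ e p]).
Proof.
move=> lp; apply/seteqP; split => w /= h p /=.
  by rewrite inE => pl; rewrite sign_ofE ?prime_gt0 ?lp // h.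
move=> pl; have := h p; rewrite /= inE => /(_ pl).
have n1 : ((-1 : R) == 1) = false.
  by rewrite eq_sym -addr_eq0 (_ : 1 + 1 = 2) ?pnatr_eq0.
rewrite sign_ofE ?prime_gt0 ?lp //; case: (sign_of w p) (e p) => [] [] //=;
  by rewrite ?expr0 ?expr1 => /eqP; rewrite ?n1 // eq_sym n1.
Qed.

Lemma measurable_cylinder l e : {in l, forall p, prime p} -> measurable (cylinder l e).
Proof.
by move=> lp; rewrite cylinderE //; apply: fin_bigcap_measurable.
Qed.

Lemma cylinder_prob l e : {in l, forall p, prime p} -> uniq l ->
  P (cylinder l e) = (2^-1 ^+ size l)%:E.
Proof.
move=> lp ul; rewrite cylinderE // (ext_rademacher_indep fP) //; last first.
  by move=> p /=; rewrite inE => /lp.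
rewrite (eq_big_seq (fun=> (2^-1)%:E)); last first.
  move=> p; rewrite inE => /lp pp; have [h1 h2] := ext_rademacher_law fP pp.
  by case: (e p); rewrite ?expr0 ?expr1.
rewrite prodEFin big_const_seq count_predT iter_mulr_1.
by rewrite (card_fseq l) undup_id.
Qed.

(** The signs on [l'] are fixed and those on [l] averaged. The induction moves [p] from [l] to [l'],
    splitting the event into the two halves given by the sign of [p]. *)
Lemma law_cylinder (B : signs -> bool) l l' e :
  {in l ++ l', forall p, prime p} -> uniq (l ++ l') ->
  (forall e1 e2, {in l ++ l', e1 =1 e2} -> B e1 = B e2) ->
  measurable (cylinder l' e `&` [set w | B (sign_of w)]) /\
  P (cylinder l' e `&` [set w | B (sign_of w)]) =
    (2^-1 ^+ size l' * avg l (fun e => (B e)%:R) e)%:E.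
Proof.
elim: l l' e => [|p l IH] l' e /= lp ul Bdep.
  case: (boolP (B e)) => Be.
    have -> : cylinder l' e `&` [set w | B (sign_of w)] = cylinder l' e.
      by apply/seteqP; split => w /= => [[]//|h]; split => //; rewrite (Bdep _ e).
    by rewrite mulr1; split; [exact: measurable_cylinder|exact: cylinder_prob].
  have -> : cylinder l' e `&` [set w | B (sign_of w)] = set0.
    apply/seteqP; split => w //= [h]; rewrite (Bdep _ e) //; exact/negP.
  by rewrite mulr0 measure0; split.
have perm : perm_eq (l ++ p :: l') (p :: l ++ l') by rewrite -cat1s perm_catCA.
case/andP: (ul); rewrite mem_cat negb_or => /andP[pl pl'] _.
pose X c := cylinder (p :: l') (upd e p c) `&` [set w | B (sign_of w)].
have XE c : measurable (X c) /\
    P (X c) = (2^-1 ^+ (size l').+1 * avg l (fun e => (B e)%:R) (upd e p c))%:E.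
  apply: IH.
  - by move=> q; rewrite (perm_mem perm); exact: lp.
  - by rewrite (perm_uniq perm).
  - by move=> e1 e2 h; apply: Bdep => q ql; apply: h; rewrite (perm_mem perm).
have cylE c w : cylinder (p :: l') (upd e p c) w <-> sign_of w p = c /\ cylinder l' e w.
  split=> [h|[wp h] q].
    split; first by rewrite h ?mem_head // /upd eqxx.
    move=> q ql; rewrite h ?inE ?ql ?orbT // /upd ifN //.
    by apply: contraNneq pl' => <-.
  by rewrite inE /upd; case: eqP => [->//|_] /=; exact: h.
have -> : cylinder l' e `&` [set w | B (sign_of w)] = X false `|` X true.
  apply/seteqP; split => w.
    move=> [h1 h2]; case wp : (sign_of w p); [right|left]; split => //; exact/cylE.
  by move=> [] [/cylE[_ ?] ?]; split.
have [mf Pf] := XE false; have [mt Pt] := XE true.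
split; first exact: measurableU.
have X0 : X false `&` X true = set0.
  by apply/seteqP; split => w // [[/cylE[h _] _] [/cylE[h' _] _]]; rewrite h in h'.
have -> : P (X false `|` X true) = (P (X false) + P (X true))%E by exact: measureU.
rewrite Pf Pt -EFinD /avg1 exprSr; congr (_%:E).
by field.
Qed.

Lemma law_event (B : signs -> bool) N e :
  (forall e1 e2, (forall p, prime p -> (p <= N)%N -> e1 p = e2 p) -> B e1 = B e2) ->
  measurable [set w | B (sign_of w)] /\
  P [set w | B (sign_of w)] = (avg (primes_in 0 N) (fun e => (B e)%:R) e)%:E.
Proof.
move=> Bdep; have := @law_cylinder B (primes_in 0 N) [::] e.
rewrite cats0 expr0 mul1r (_ : cylinder _ _ = setT) ?setTI; last first.
  by apply/seteqP; split.
apply; last 1 first.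
- move=> e1 e2 h; apply: Bdep => p pp pN; apply: h.
  by rewrite mem_primes_in pp prime_gt0.
- by move=> p; rewrite mem_primes_in => /and3P[].
- exact: primes_in_uniq.
Qed.

End Law.

(** * Growth of the scales and the almost sure conclusion *)

Lemma sign_changes_psum (R : realType) chi (eps : signs) (a : nat -> R) x :
  (forall n, (0 < n)%N -> a n = hval R chi eps n) ->
  sign_changes a x = nchanges R chi eps (Num.truncn x).
Proof.
move=> h; rewrite /sign_changes /nchanges /nz_sums.
congr (qe_rcf_th.changes [seq z <- _ | z != 0]).
by apply: eq_map => m; apply: eq_big_nat => n /andP[n0 _]; exact: h.
Qed.

Lemma geometric_sum_le (R : realType) (C r : R) n : 0 <= C -> 0 <= r < 1 ->
  \sum_(0 <= k < n) C * r ^+ k <= C / (1 - r).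
Proof.
move=> C0 /andP[r0 r1]; rewrite ler_pdivlMr ?subr_gt0 // mulr_suml.
apply: le_trans (_ : C - C * r ^+ n <= _); last by rewrite gerBl mulr_ge0 ?exprn_ge0.
elim: n => [|n IH]; first by rewrite big_geq // expr0 mulr1 subrr.
by rewrite big_nat_recr //= exprS; lra.
Qed.

Lemma scale_itv e0 n t : (0 < e0)%N -> (scale e0 n <= t)%N ->
  exists2 k, (n <= k)%N & (scale e0 k <= t < scale e0 k.+1)%N.
Proof.
move=> e00; elim: t => [|t IH].
  by rewrite leqNgt expn_gt0.
rewrite leq_eqVlt => /orP[/eqP <-|].
  exists n => //; rewrite leqnn /= ltn_exp2l // ltn_pmul2r // ltn_exp2l //.
rewrite ltnS => /IH[k nk /andP[k1 k2]].
have [h|h] := ltnP t.+1 (scale e0 k.+1); first by exists k => //; rewrite h leqW.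
exists k.+1; first exact: leqW.
rewrite h /= (leq_ltn_trans k2) // ltn_exp2l // ltn_pmul2r // ltn_exp2l //.
Qed.

Lemma ln_le_id (R : realType) (x : R) : 0 < x -> ln x <= x.
Proof.
move=> x0; rewrite -ler_expR lnK ?posrE //.
by apply: le_trans (expR_ge1Dx x); rewrite lerDr.
Qed.

(** As ln 2 <= 1, ln x is at most 10^(k+1) e0. The crude bounds ln 10 <= 10 and ln e0 <= e0 then
    give 10 (k + 1) + e0, and k >= 1 absorbs the constants. *)
Lemma lnln_scale (R : realType) e0 k (x : R) : (0 < e0)%N -> (0 < k)%N ->
  2 <= x -> x <= (scale e0 k.+1)%:R -> ln (ln x) <= (20 + e0%:R) * k%:R.
Proof.
move=> e00 k0 x2 xs; have x0 : 0 < x by lra.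
have e0R : 1 <= e0%:R :> R by rewrite ler1n.
have l2 : ln (2 : R) <= 1.
  rewrite -ler_expR lnK ?posrE //; have := expR_ge1Dx (1 : R); lra.
have lx0 : 0 < ln x by rewrite ln_gt0 //; lra.
have l10 : ln (10 : R) <= 10 by apply: ln_le_id; rewrite ltr0n.
have lx : ln x <= 10 ^+ k.+1 * e0%:R.
  apply: le_trans (_ : ln ((2 : R) ^+ scale_exp e0 k.+1) <= _).
    by rewrite ler_ln ?posrE ?exprn_gt0 // -natrX.
  rewrite lnXn // -[leLHS]mulr_natr /scale_exp natrM natrX ler_piMl // mulr_ge0 ?exprn_ge0 //.
have p10 : 0 < 10 ^+ k.+1 :> R by rewrite exprn_gt0 // ltr0n.
apply: le_trans (_ : ln (10 ^+ k.+1 * e0%:R) <= _).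
  by rewrite ler_ln ?posrE ?mulr_gt0 //; lra.
rewrite lnM ?posrE //; last by lra.
rewrite lnXn ?ltr0n // -[X in X + _]mulr_natr.
have h1 : ln (10 : R) * k.+1%:R <= 10 * k.+1%:R by rewrite ler_wpM2r.
have h2 : ln (e0%:R : R) <= e0%:R by apply: ln_le_id; lra.
have k1 : 1 <= k%:R :> R by rewrite ler1n.
rewrite -[k.+1%:R]natr1 in h1 *.
have : e0%:R * 1 <= e0%:R * k%:R :> R by rewrite ler_wpM2l //; lra.
lra.
Qed.

Theorem corollary1p6 (R : realType) :
  exists2 c : R, 0 < c &
  forall (d : measure_display) (T : measurableType d) (P : probability T R)
    (f : nat -> {RV P >-> R}),
  extended_rademacher f ->
  let g : nat -> T -> R := fun n w => (mobius n)%:~R ^+ 2 * f n w in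
  forall h : nat -> T -> R,
  (h = (fun n => f n : T -> R) \/ h = g) ->
  {ae P, forall w, \forall x \near +oo,
    c * ln (ln x) <= (sign_changes (fun n => h n w) x)%:R}.
Proof.
have [m [e0 [r [C [m0 e00 r01 C0 tail]]]]] := few_changes_tail R.
have cpos : 0 < m%:R * (20 + e0%:R) :> R by rewrite mulr_gt0 ?ltr0n // ltr_wpDr.
(* Eventually k < m N at the scale k below x, while ln ln x is at most (20 + e0) k. *)
exists (m%:R * (20 + e0%:R))^-1; first by rewrite invr_gt0.
move=> d T P f fP g h hfg.
have [chi [chiP hE]] : exists chi, support_ok chi /\
    forall n w, (0 < n)%N -> h n w = hval R chi (sign_of f w) n.
  case: hfg => ->.
    exists predT; split; first exact: support_all.
    by move=> n w n0; rewrite (rademacher_mulsgn fP) // /hval mul1r.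
  exists squarefree; split; first exact: support_squarefree.
  by move=> n w n0; rewrite /g mobius_sqr (rademacher_mulsgn fP).
pose B k (e : signs) := (m * nchanges R chi e (scale e0 k) <= k)%N.
pose A k := [set w | B k (sign_of f w)].
have AP k : measurable (A k) /\
    P (A k) = (avg (primes_in 0 (scale e0 k)) (fun e => (B k e)%:R) (fun=> false))%:E.
  by apply: law_event => // e1 e2 he; rewrite /B /nchanges (nz_sums_dep _ _ he).
have PA k : (P (A k) <= (C * r ^+ k)%:E)%E.
  by rewrite (AP k).2 lee_fin; exact: tail.
(* Borel-Cantelli: the probabilities are dominated by a geometric series. *)
have A0 : P (lim_sup_set A) = 0%E.
  apply: lim_sup_set_cvg0; first by move=> k; exact: (AP k).1.
  apply: le_lt_trans (ltry (C / (1 - r))).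
  apply: lime_le; first by apply: is_cvg_nneseries.
  apply: nearW => n; apply: le_trans (_ : ((\sum_(0 <= k < n) C * r ^+ k)%:E <= _)%E).
    rewrite -sumEFin; by apply: lee_sum => k _; exact: PA.
  by rewrite lee_fin geometric_sum_le.
exists (lim_sup_set A); split => //.
  apply: bigcap_measurable; first by exists 0%N.
  by move=> n _; apply: bigcup_measurable => k _; exact: (AP k).1.
move=> w /= hw; apply: contrapT => wA; apply: hw.
have [n nA] : exists n, forall k, (n <= k)%N -> ~ A k w.
  apply: contrapT => hn; apply: wA => n _; apply: contrapT => hk; apply: hn.
  by exists n => k nk Ak; apply: hk; exists k.
(* Starting at index [n.+1] rather than [n] ensures that the scale index [k] found below is
   positive, as [lnln_scale] requires. *)
exists (scale e0 n.+1)%:R; split; first exact: num_real.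
move=> x xs; have x0 : 0 <= x by apply: le_trans (ltW xs).
rewrite (sign_changes_psum (chi := chi) (eps := sign_of f w));
  last by move=> k k0; exact: hE.
set t := Num.truncn x.
have st : (scale e0 n.+1 <= t)%N by rewrite truncn_ge_nat // ltW.
have [k nk /andP[kt tk]] := scale_itv e00 st.
have kN : (k < m * nchanges R chi (sign_of f w) t)%N.
  have /negP := nA k (ltnW nk); rewrite -ltnNge => /leq_trans; apply.
  by rewrite leq_mul2l nchanges_le ?orbT.
rewrite mulrC ler_pdivrMr //.
apply: le_trans (_ : (20 + e0%:R) * k%:R <= _).
  apply: lnln_scale => //; first by apply: leq_trans nk.
    apply: le_trans (ltW xs); rewrite (_ : 2 = (2 ^ 1)%:R :> R) // ler_nat leq_exp2l //.
    by rewrite muln_gt0 expn_gt0.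
  by rewrite ltW // -truncn_lt_nat.
by rewrite mulrA [leRHS]mulrC ler_wpM2l ?addr_ge0 // -natrM ler_nat mulnC ltnW.
Qed.
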